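(* Let $\mathbf{k}$ be an algebraically closed field of characteristic zero and let $\Delta$ be a simplicial complex on $[n]$. The weights of the root subgroups of $\operatorname{Aut}(X_\Delta)$ with respect to $T_0$ are exactly the Demazure roots $\alpha\in\mathcal R(\Delta)$.
   Context: $\mathbf{k}$ is an algebraically closed field of characteristic zero. For $n\ge 1$, $[n]=\{1,\dots,n\}$. A simplicial complex $\Delta$ on $[n]$ is a collection of subsets of $[n]$ (faces) closed under taking subsets; it is always assumed that $\{i\}\in\Delta$ for every $i\in[n]$. Facets are the inclusion-maximal faces. For a face $S$, $\operatorname{cl}(S)$ is the intersection of all facets containing $S$. For $i\in[n]$, $\mathcal A_i(\Delta)=\{S\subseteq[n]\setminus\{i\}: S\in\Delta,\ i\in\operatorname{cl}(S)\}$. With $\mathbf e_i$ the standard basis vectors of $\mathbb Z^n$ and $\operatorname{supp}(a)=\{i:a_i\ne0\}$, the set of Demazure roots is $\mathcal R(\Delta)=\{\beta-\mathbf e_i: i\in[n],\ \beta\in\mathbb Z^n_{\ge0},\ \beta_i=0,\ \operatorname{supp}(\beta)\in\mathcal A_i(\Delta)\}$. $\mathbf k[\Delta]=\mathbf k[x_1,\dots,x_n]/I_\Delta$ with $I_\Delta=(\prod_{i\in\sigma}x_i:\sigma\subseteq[n],\sigma\notin\Delta)$, $X_\Delta=\operatorname{Spec}\mathbf k[\Delta]$, and $\overline{x}_i$ is the class of $x_i$. Ind-groups: an ind-variety is a set $\mathcal V$ with an ascending filtration $\mathcal V_0\subseteq\mathcal V_1\subseteq\cdots$ with union $\mathcal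 V$, each $\mathcal V_k$ an algebraic variety and each inclusion a closed immersion; morphisms are maps sending each filtration piece into some filtration piece by a morphism of varieties. An ind-group is a group with an ind-variety structure for which multiplication and inversion are morphisms. $\operatorname{Aut}(X_\Delta)=\operatorname{Aut}_{\mathbf k}(\mathbf k[\Delta])$ is an ind-group: $\varphi$ is identified with $(\varphi,\varphi^{-1})$, each endomorphism being given by the tuple of images of $\overline x_1,\dots,\overline x_n$, and the $d$-th filtration piece consists of pairs for which $\varphi$ and $\varphi^{-1}$ both send every $\overline{x}_l$ to an element of total degree at most $d$. An algebraic subgroup of an ind-group $\mathcal G=\bigcup_k\mathcal G_k$ is a subgroup that is a closed algebraic subvariety of some $\mathcal G_k$; a torus in $\mathcal G$ is an algebraic subgroup isomorphic to some $(\mathbf k^* )^m$. A root subgroup of $\mathcal G$ with respect to a torus $T\subseteq\mathcal G$ is an algebraic subgroup $U\subseteq\mathcal G$ isomorphic to $\mathbb G_{\mathrm a}=(\mathbf k,+)$ for which there are an isomorphism $\varepsilon:\mathbb G_{\mathrm a}\to U$ and a nontrivial character $\alpha\in X(T)=\operatorname{Hom}(T,\mathbb G_{\mathrm m})$ with $t\,\varepsilon(s)\,t^{-1}=\varepsilon(\alpha(t)s)$ for all $t\in T$, $s\in\mathbb G_{\mathrm a}$; $\alpha$ is the weight of $U$. $T_0=(\mathbf k^* )^n$ is embedded in $\operatorname{Aut}(X_\Delta)$ via $t\cdot\overline x_i=t_i\overline x_i$, and $X(T_0)$ is identified with $\mathbb Z^n$ ($a\in\mathbb Z^n$ corresponding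 to $t\mapsto t^a=\prod t_i^{a_i}$). *)

(* Defs.v *)
From HB Require Import structures.
From mathcomp Require Import all_boot all_order all_algebra.
From mathcomp Require Import generic_quotient ring_quotient.
From mathcomp Require Import mpoly boolp zify.

Set Implicit Arguments.
Unset Strict Implicit.
Unset Printing Implicit Defensive.

Import GRing.Theory.
Local Open Scope ring_scope.

Section AffineVarieties.
Variable k : closedFieldType.

Definition polyval (J : finType) (p : {mpoly k[#|J|]}) (v : J -> k) : k :=
  p.@[fun i => v (enum_val i)].

Definition zero_locus (J : finType) (E : {mpoly k[#|J|]} -> Prop)
  (v : J -> k) : Prop := forall p, E p -> polyval p v = 0.

(* A (reduced, possibly reducible) affine variety whose points form the subset
   [carrier] of the ambient type [V]: the coordinates identify [carrier] with
   a Zariski closed subset of the affine space over [k] indexed by [coord_ix]. *)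
Record affine_variety (V : Type) := AffineVariety {
  carrier :> V -> Prop;
  coord_ix : finType;
  coord : V -> coord_ix -> k;
  coord_inj : forall x y,
    carrier x -> carrier y -> coord x =1 coord y -> x = y;
  coord_closed : exists E, forall v,
    zero_locus E v <-> exists2 x, carrier x & coord x =1 v }.
Arguments coord {V} X x j : rename.

Definition regular V (X : affine_variety V) (f : V -> k) : Prop :=
  exists p, forall x, X x -> f x = polyval p (coord X x).

Definition morphism V W (X : affine_variety V) (Y : affine_variety W)
  (f : V -> W) : Prop :=
  (forall x, X x -> Y (f x)) /\
  (forall j, regular X (fun x => coord Y (f x) j)).

Definition isomorphism V W (X : affine_variety V) (Y : affine_variety W)
  (f : V -> W) : Prop :=
  morphism X Y f /\
  exists g, [/\ morphism Y X g,
                forall x, X x -> g (f x) = x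
              & forall y, Y y -> f (g y) = y].

Definition closed_in V (X : affine_variety V) (Z : V -> Prop) : Prop :=
  (forall x, Z x -> X x) /\
  exists E, forall x, X x -> Z x <-> zero_locus E (coord X x).

Lemma polyval_eq (J : finType) (p : {mpoly k[#|J|]}) v w :
  v =1 w -> polyval p v = polyval p w.
Proof. by move=> e; apply: meval_eq => i; apply: e. Qed.

Lemma subvariety_closed V (X : affine_variety V) Z : closed_in X Z ->
  exists E, forall v, zero_locus E v <-> exists2 x, Z x & coord X x =1 v.
Proof.
move=> [ZX [E EP]]; have [F FP] := coord_closed X.
exists (fun p => E p \/ F p) => v; split=> [h|[x Zx xv] p].
  have [|x Xx xv] := (FP v).1; first by move=> p Fp; apply: h; right.
  exists x => //; apply/(EP _ Xx) => p Ep.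
  by rewrite (polyval_eq _ xv); apply: h; left.
rewrite -(polyval_eq _ xv) => -[Ep|Fp].
  exact: (EP _ (ZX _ Zx)).1.
by apply: (FP _).2 Fp; exists x => //; apply: ZX.
Qed.

Definition subvariety V (X : affine_variety V) (Z : V -> Prop)
  (hZ : closed_in X Z) : affine_variety V :=
  @AffineVariety V Z _ (coord X)
    (fun x y Zx Zy => coord_inj (hZ.1 x Zx) (hZ.1 y Zy))
    (subvariety_closed hZ).

Definition closed_immersion V W (X : affine_variety V) (Y : affine_variety W)
  (f : V -> W) : Prop :=
  exists hZ : closed_in Y (fun y => exists2 x, X x & y = f x),
    isomorphism X (subvariety hZ) f.

Lemma affine_space_inj (J : finType) (v w : J -> k) :
  True -> True -> v =1 w -> v = w.
Proof. by move=> _ _ e; apply: funext. Qed.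

Lemma affine_space_closed (J : finType) :
  exists E, forall v : J -> k,
    zero_locus E v <-> exists2 x : J -> k, True & id x =1 v.
Proof. by exists (fun=> False) => v; split=> [_|_ p []]; exists v. Qed.

Definition affine_space (J : finType) : affine_variety (J -> k) :=
  @AffineVariety _ _ J id (@affine_space_inj J) (affine_space_closed J).

Section Regular.
Variables (V : Type) (X : affine_variety V).

Lemma eq_regular f g : (forall x, X x -> f x = g x) ->
  regular X f -> regular X g.
Proof. by move=> e [p hp]; exists p => x Xx; rewrite -e ?hp. Qed.

Lemma regular_cst c : regular X (fun=> c).
Proof. by exists c%:MP => x _; rewrite /polyval mevalC. Qed.

Lemma regular_coord j : regular X (fun x => coord X x j).
Proof.
by exists 'X_(enum_rank j) => x _; rewrite /polyval mevalXU enum_rankK.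
Qed.

Lemma regularD f g : regular X f -> regular X g ->
  regular X (fun x => f x + g x).
Proof.
move=> [p hp] [q hq]; exists (p + q) => x Xx.
by rewrite hp ?hq // /polyval mevalD.
Qed.

Lemma regularM f g : regular X f -> regular X g ->
  regular X (fun x => f x * g x).
Proof.
move=> [p hp] [q hq]; exists (p * q) => x Xx.
by rewrite hp ?hq // /polyval mevalM.
Qed.

Lemma regularB f g : regular X f -> regular X g ->
  regular X (fun x => f x - g x).
Proof.
move=> [p hp] [q hq]; exists (p - q) => x Xx.
by rewrite hp ?hq // /polyval mevalB.
Qed.

Lemma regular_sum I (r : seq I) (P : pred I) (F : I -> V -> k) :
  (forall i, P i -> regular X (F i)) ->
  regular X (fun x => \sum_(i <- r | P i) F i x).
Proof.
move=> h; elim: r => [|i r IH].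
  by apply: eq_regular (regular_cst 0) => x _; rewrite big_nil.
case Pi: (P i).
  apply: eq_regular (regularD (h i Pi) IH) => x _.
  by rewrite big_cons Pi.
by apply: eq_regular IH => x _; rewrite big_cons Pi.
Qed.

Lemma regular_prod I (r : seq I) (P : pred I) (F : I -> V -> k) :
  (forall i, P i -> regular X (F i)) ->
  regular X (fun x => \prod_(i <- r | P i) F i x).
Proof.
move=> h; elim: r => [|i r IH].
  by apply: eq_regular (regular_cst 1) => x _; rewrite big_nil.
case Pi: (P i).
  apply: eq_regular (regularM (h i Pi) IH) => x _.
  by rewrite big_cons Pi.
by apply: eq_regular IH => x _; rewrite big_cons Pi.
Qed.

Lemma regular_exp f m : regular X f -> regular X (fun x => f x ^+ m).
Proof. by move=> [p hp]; exists (p ^+ m) => x Xx; rewrite hp // /polyval rmorphXn. Qed.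

Lemma regular_polyval (J : finType) (p : {mpoly k[#|J|]}) (f : V -> J -> k) :
  (forall j, regular X (fun x => f x j)) ->
  regular X (fun x => polyval p (f x)).
Proof.
move=> h.
apply: (@eq_regular
  (fun x => \sum_(m <- msupp p) p@_m * \prod_i f x (enum_val i) ^+ m i)).
  by move=> x _; rewrite /polyval mevalE.
apply: regular_sum => m _; apply: regularM; first exact: regular_cst.
by apply: regular_prod => i _; apply: regular_exp.
Qed.

Lemma closed_by (Z : V -> Prop) (F : (V -> k) -> Prop) :
  (forall f, F f -> regular X f) ->
  (forall x, Z x <-> X x /\ forall f, F f -> f x = 0) -> closed_in X Z.
Proof.
move=> hF hZ; split=> [x /hZ[]//|].
exists (fun p => exists2 f, F f & forall x, X x -> f x = polyval p (coord X x)).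
move=> x Xx; split=> [/hZ[_ h] p [f Ff fp]|h]; first by rewrite -fp ?h.
apply/hZ; split=> // f Ff; have [p hp] := hF f Ff.
by rewrite hp //; apply: h; exists f.
Qed.

End Regular.

Lemma regular_proj (J : finType) (j : J) :
  regular (affine_space J) (fun v => v j).
Proof. exact: (@regular_coord _ (affine_space J)). Qed.

Lemma closed_image_by (J : finType) V (S : V -> Prop) (c : V -> J -> k)
    (F : ((J -> k) -> k) -> Prop) :
  (forall f, F f -> regular (affine_space J) f) ->
  (forall v, (forall f, F f -> f v = 0) <-> exists2 x, S x & c x =1 v) ->
  exists E, forall v, zero_locus E v <-> exists2 x, S x & c x =1 v.
Proof.
move=> hF hS.
have [|_ [E hE]] := closed_by (Z := fun v => exists2 x, S x & c x =1 v) hF.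
  by move=> v; rewrite -hS; split=> // -[].
by exists E => v; rewrite -(hE v).
Qed.

Lemma product_inj V W (X : affine_variety V) (Y : affine_variety W)
    (c := fun (z : V * W) (j : coord_ix X + coord_ix Y) =>
       match j with inl a => coord X z.1 a | inr b => coord Y z.2 b end) z w :
  X z.1 /\ Y z.2 -> X w.1 /\ Y w.2 -> c z =1 c w -> z = w.
Proof.
case: z w => [x y] [x' y'] /= [Xx Yy] [Xx' Yy'] e; congr pair.
  by apply: (@coord_inj _ X) => // j; apply: (e (inl j)).
by apply: (@coord_inj _ Y) => // j; apply: (e (inr j)).
Qed.

Lemma product_closed V W (X : affine_variety V) (Y : affine_variety W)
    (c := fun (z : V * W) (j : coord_ix X + coord_ix Y) =>
       match j with inl a => coord X z.1 a | inr b => coord Y z.2 b end) :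
  exists E, forall v,
    zero_locus E v <-> exists2 z, X z.1 /\ Y z.2 & c z =1 v.
Proof.
have [E EP] := coord_closed X; have [F FP] := coord_closed Y.
apply: (@closed_image_by _ _ _ _ (fun f =>
  (exists2 p, E p & f = fun v => polyval p (fun a => v (inl a))) \/
  (exists2 p, F p & f = fun v => polyval p (fun b => v (inr b))))).
  move=> f [] [p _ ->]; apply: regular_polyval => j.
    exact: regular_proj.
  exact: regular_proj.
move=> v; split=> [h|[[x y] /= [Xx Yy] e] f].
  have [|x Xx ex] := (EP (fun a => v (inl a))).1.
    by move=> p Ep; apply: (h (fun v => polyval p _)); left; exists p.
  have [|y Yy ey] := (FP (fun b => v (inr b))).1.
    by move=> p Ep; apply: (h (fun v => polyval p _)); right; exists p.
  by exists (x, y) => //= -[j|j] /=.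
case=> -[p hp ->].
  by apply: (EP _).2 hp; exists x => // j; apply: (e (inl j)).
by apply: (FP _).2 hp; exists y => // j; apply: (e (inr j)).
Qed.

Definition product V W (X : affine_variety V) (Y : affine_variety W) :
  affine_variety (V * W) :=
  AffineVariety (@product_inj _ _ X Y) (@product_closed _ _ X Y).

Lemma regular_comp V W (X : affine_variety V) (Y : affine_variety W) f g :
  morphism X Y f -> regular Y g -> regular X (fun x => g (f x)).
Proof.
move=> [fX hf] [p hp]; apply: eq_regular (regular_polyval p hf) => x Xx.
by rewrite hp //; apply: fX.
Qed.

Lemma morphism_fst V W (X : affine_variety V) (Y : affine_variety W) :
  morphism (product X Y) X fst.
Proof.
split=> [x []//|j].
exact: (@regular_coord _ (product X Y) (inl j)).
Qed.

Lemma morphism_snd V W (X : affine_variety V) (Y : affine_variety W) :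
  morphism (product X Y) Y snd.
Proof.
split=> [x []//|j].
exact: (@regular_coord _ (product X Y) (inr j)).
Qed.

Lemma regular_sub V (X : affine_variety V) Z (hZ : closed_in X Z) f :
  regular X f -> regular (subvariety hZ) f.
Proof. by move=> [p hp]; exists p => x /hZ.1; apply: hp. Qed.

Lemma Ga_inj (x y : k) : True -> True -> (fun _ : unit => x) =1 (fun=> y) ->
  x = y.
Proof. by move=> _ _ /(_ tt). Qed.

Lemma Ga_closed : exists E, forall v : unit -> k,
  zero_locus E v <-> exists2 x, True & (fun=> x) =1 v.
Proof.
exists (fun=> False) => v; split=> [_|_ p []//].
by exists (v tt) => // -[].
Qed.

Definition Ga : affine_variety k := AffineVariety Ga_inj Ga_closed.

(* Invertible scalars are embedded in the affine plane by t |-> (t, t^-1). *)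
Definition Gm_coord (t : k) (b : bool) : k := if b then t else t^-1.

Lemma Gm_inj (s t : k) : s != 0 -> t != 0 ->
  Gm_coord s =1 Gm_coord t -> s = t.
Proof. by move=> _ _ /(_ true). Qed.

Lemma Gm_closed : exists E, forall v,
  zero_locus E v <-> exists2 t : k, t != 0 & Gm_coord t =1 v.
Proof.
apply: (@closed_image_by _ _ _ _ (fun f => f = fun v => v true * v false - 1)).
  move=> f ->; apply: regularB; last exact: regular_cst.
  by apply: regularM; apply: regular_proj.
move=> v; split=> [/(_ _ erefl)/eqP|[t t0 e] f ->]; last first.
  by rewrite -!e /= divff // subrr.
rewrite subr_eq0 => /eqP h; exists (v true).
  by apply/eqP => v0; move/eqP: h; rewrite v0 mul0r eq_sym oner_eq0.
have v0 : v true != 0.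
  by apply/eqP => v0; move/eqP: h; rewrite v0 mul0r eq_sym oner_eq0.
by case=> //=; apply: (mulfI v0); rewrite h divff.
Qed.

Definition Gm : affine_variety k := AffineVariety Gm_inj Gm_closed.

Definition std_torus_coord m (t : 'I_m -> k) (j : 'I_m * bool) : k :=
  Gm_coord (t j.1) j.2.

Lemma std_torus_inj m (s t : 'I_m -> k) :
  (forall i, s i != 0) -> (forall i, t i != 0) ->
  std_torus_coord s =1 std_torus_coord t -> s = t.
Proof. by move=> _ _ e; apply: funext => i; apply: (e (i, true)). Qed.

Lemma std_torus_closed m : exists E, forall v,
  zero_locus E v <->
  exists2 t : 'I_m -> k, (forall i, t i != 0) & std_torus_coord t =1 v.
Proof.
apply: (@closed_image_by _ _ _ _ (fun f =>
  exists i, f = fun v => v (i, true) * v (i, false) - 1)).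
  move=> f [i ->]; apply: regularB; last exact: regular_cst.
  by apply: regularM; apply: regular_proj.
move=> v; split=> [h|[t t0 e] f [i ->]]; last first.
  by rewrite -!e /std_torus_coord /= divff // subrr.
have h1 i : v (i, true) * v (i, false) = 1.
  by apply/eqP; rewrite -subr_eq0; apply/eqP; apply: (h (fun v => _)); exists i.
have v0 i : v (i, true) != 0.
  by apply/eqP => v0; move/eqP: (h1 i); rewrite v0 mul0r eq_sym oner_eq0.
exists (fun i => v (i, true)) => // -[i []] //=.
by rewrite /std_torus_coord /=; apply: (mulfI (v0 i)); rewrite h1 divff.
Qed.

Definition std_torus m : affine_variety ('I_m -> k) :=
  AffineVariety (@std_torus_inj m) (@std_torus_closed m).

(* Ind-groups all of whose filtration pieces are affine varieties. The product
   ind-variety is filtered by the products of the pieces of equal index. *)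
Record ind_group := IndGroup {
  ind_sort :> groupType;
  piece : nat -> affine_variety ind_sort;
  piece_cover : forall g, exists d, piece d g;
  piece_incl : forall d, closed_immersion (piece d) (piece d.+1) id;
  ind_mul : forall d, exists e,
    morphism (product (piece d) (piece d)) (piece e)
             (fun gh => (gh.1 * gh.2)%g);
  ind_inv : forall d, exists e,
    morphism (piece d) (piece e) (fun g => (g^-1)%g) }.

Record algebraic_subgroup (G : ind_group) := AlgebraicSubgroup {
  asg_set : G -> Prop;
  asg_level : nat;
  asg_closed : closed_in (piece G asg_level) asg_set;
  asg1 : asg_set 1%g;
  asgM : forall g h, asg_set g -> asg_set h -> asg_set (g * h)%g;
  asgV : forall g, asg_set g -> asg_set (g^-1)%g }.

Definition asg_variety (G : ind_group) (H : algebraic_subgroup G) :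
  affine_variety G := subvariety (asg_closed H).
Coercion asg_variety : algebraic_subgroup >-> affine_variety.

Record torus (G : ind_group) := Torus {
  torus_asg :> algebraic_subgroup G;
  torus_iso : exists m (e : ('I_m -> k) -> G),
    isomorphism (std_torus m) torus_asg e /\
    forall s t, std_torus m s -> std_torus m t ->
      e (fun i => s i * t i) = (e s * e t)%g }.

Record character (G : ind_group) (T : torus G) := Character {
  char_fun :> G -> k;
  char_morph : morphism T Gm char_fun;
  char_mul : forall s t, T s -> T t ->
    char_fun (s * t)%g = char_fun s * char_fun t }.

Definition root_subgroup (G : ind_group) (T : torus G)
  (U : algebraic_subgroup G) (alpha : character T) : Prop :=
  exists e : k -> G,
    [/\ isomorphism Ga U e,
        forall s s', e (s + s') = (e s * e s')%g,
        exists2 t, T t & alpha t != 1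
      & forall t s, T t -> (t * e s * t^-1)%g = e (alpha t * s)].

Definition root_weight (G : ind_group) (T : torus G) (alpha : character T) :
  Prop := exists U : algebraic_subgroup G, root_subgroup U alpha.

End AffineVarieties.

Section SimplicialComplexes.
Variable n : nat.

Record simplicial_complex := SimplicialComplex {
  faces : {set {set 'I_n}};
  vertices_gt0 : (0 < n)%N;
  face_subset : forall S T : {set 'I_n},
    S \in faces -> T \subset S -> T \in faces;
  vertex_face : forall i, [set i] \in faces }.

Variable D : simplicial_complex.

Lemma face0 : set0 \in faces D.
Proof. exact: face_subset (vertex_face D (Ordinal (vertices_gt0 D))) (sub0set _). Qed.

Definition facet (F : {set 'I_n}) : bool :=
  maxset (fun S => S \in faces D) F.

Definition face_closure (S : {set 'I_n}) : {set 'I_n} :=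
  \bigcap_(F | facet F && (S \subset F)) F.

Definition face_family (i : 'I_n) : {set {set 'I_n}} :=
  [set S in faces D | (i \notin S) && (i \in face_closure S)].

Definition demazure_root (a : 'rV[int]_n) : Prop :=
  exists (i : 'I_n) (b : 'rV[int]_n),
    [/\ forall j, 0 <= b 0 j, b 0 i = 0,
        [set j | b 0 j != 0] \in face_family i
      & a = b - delta_mx 0 i].

Definition mnm_supp (m : 'X_{1..n}) : {set 'I_n} := [set i | m i != 0%N].

Definition face_mnm (m : 'X_{1..n}) : bool := mnm_supp m \in faces D.

Lemma face_mnmD m1 m2 : face_mnm (m1 + m2)%MM -> face_mnm m1 /\ face_mnm m2.
Proof.
move=> h; split; apply: face_subset h _; apply/subsetP => i; rewrite !inE mnmDE.
  by rewrite addn_eq0 negb_and => ->.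
by rewrite addn_eq0 negb_and orbC => ->.
Qed.

Lemma face_mnm0 : face_mnm 0%MM.
Proof.
rewrite /face_mnm; suff -> : mnm_supp 0%MM = set0 by exact: face0.
by apply/setP => i; rewrite !inE mnm0E.
Qed.

Lemma face_mnmU i : face_mnm U_(i)%MM.
Proof.
rewrite /face_mnm; suff -> : mnm_supp U_(i)%MM = [set i] by exact: vertex_face.
by apply/setP => j; rewrite !inE mnm1E (eq_sym j); case: (i == j).
Qed.

End SimplicialComplexes.

Section FaceRing.
Variables (k : closedFieldType) (n : nat) (D : simplicial_complex n).

Definition SR_ideal : {pred {mpoly k[n]}} := fun p =>
  `[< exists c : {set 'I_n} -> {mpoly k[n]},
        p = \sum_(S | S \notin faces D) c S * \prod_(i in S) 'X_i >].

Lemma SR_ideal_lin a u v : u \in SR_ideal -> v \in SR_ideal ->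
  a * u + v \in SR_ideal.
Proof.
move=> /asboolP[c ->] /asboolP[d ->]; apply/asboolP.
exists (fun S => a * c S + d S); rewrite mulr_sumr -big_split /=.
by apply: eq_bigr => S _; rewrite mulrDl mulrA.
Qed.

Lemma SR_ideal0 : 0 \in SR_ideal.
Proof.
by apply/asboolP; exists (fun=> 0); rewrite big1 // => S _; rewrite mul0r.
Qed.

Lemma SR_gen S : S \notin faces D -> \prod_(i in S) 'X_i \in SR_ideal.
Proof.
move=> hS; apply/asboolP; exists (fun T => (T == S)%:R).
rewrite (bigD1 S) //= eqxx mul1r [X in _ + X]big1 ?addr0 // => T /andP[_ /negPf->].
by rewrite mul0r.
Qed.

Lemma nonface_mnm m : ~~ face_mnm D m -> 'X_[m] \in SR_ideal.
Proof.
move=> hm.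
have -> : 'X_[m] = 'X_[(m - \sum_(i in mnm_supp m) U_(i))%MM] *
                   \prod_(i in mnm_supp m) 'X_i :> {mpoly k[n]}.
  rewrite mprodXE -mpolyXD submK //; apply/mnm_lepP => i.
  rewrite mnm_sumE; case: (posnP (m i)) => [mi0|mi].
    rewrite big1 ?leq0n // => j; rewrite inE mnm1E => mj.
    by case: (j =P i) mj => // ->; rewrite mi0.
  rewrite (bigD1 i) ?inE -?lt0n //= mnm1E eqxx big1 ?addn0 //.
  by move=> j /andP[_ /negPf ji]; rewrite mnm1E ji.
by rewrite -[X in X \in _]addr0 SR_ideal_lin ?SR_ideal0 // SR_gen.
Qed.

Lemma SR_idealP p :
  p \in SR_ideal <-> forall m, face_mnm D m -> p@_m = 0.
Proof.
split=> [/asboolP[c ->] m hm|h].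
  rewrite raddf_sum /= big1 // => S hS; rewrite mprodXE mcoeffM big1 //.
  case=> m1 m2 /= /eqP e; rewrite mcoeffX; case: eqP => [e2|]; last by rewrite mulr0.
  case/negP: hS; apply: face_subset hm _; apply/subsetP => i iS.
  rewrite inE e mnmDE -e2 mnm_sumE addn_eq0 negb_and; apply/orP; right.
  by rewrite (bigD1 i) //= mnm1E eqxx.
rewrite [p]mpolyE big_seq; elim/big_ind: _ => [|x y hx hy|m hm].
- exact: SR_ideal0.
- by rewrite -[x]mul1r SR_ideal_lin.
rewrite -mul_mpolyC -[_ * _]addr0 SR_ideal_lin ?SR_ideal0 //.
apply: nonface_mnm; apply/negP => /h; apply/eqP.
by rewrite mcoeff_msupp in hm.
Qed.

Lemma SR_idealr_closed : idealr_closed SR_ideal.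
Proof.
split=> [|| a u v]; [exact: SR_ideal0 | | exact: SR_ideal_lin].
apply/negP => /SR_idealP/(_ _ (face_mnm0 D))/eqP.
by rewrite mcoeff1 eqxx oner_eq0.
Qed.

HB.instance Definition _ :=
  isIdealr.Build {mpoly k[n]} SR_ideal SR_idealr_closed.

Definition face_ring := {ideal_quot SR_ideal}.
HB.instance Definition _ := GRing.ComNzRing.on face_ring.

Definition face_class (p : {mpoly k[n]}) : face_ring :=
  (\pi_({ideal_quot SR_ideal}) p)%qT.

Lemma face_class_zmod : zmod_morphism face_class.
Proof. by move=> p q; rewrite /face_class raddfB. Qed.
Lemma face_class_monoid : monoid_morphism face_class.
Proof. by split=> [|p q]; rewrite /face_class (rmorph1, rmorphM). Qed.
HB.instance Definition _ :=
  GRing.isZmodMorphism.Build _ _ face_class face_class_zmod.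
HB.instance Definition _ :=
  GRing.isMonoidMorphism.Build _ _ face_class face_class_monoid.

Definition face_repr (f : face_ring) : {mpoly k[n]} :=
  repr (f : {ideal_quot SR_ideal}).

Lemma face_reprK f : face_class (face_repr f) = f.
Proof. exact: reprK. Qed.

Lemma face_class_eq p q : face_class p = face_class q <-> p - q \in SR_ideal.
Proof.
by split=> [/eqP|h]; last apply/eqP; rewrite -Quotient.idealrBE.
Qed.

Definition face_scale (c : k) (f : face_ring) : face_ring :=
  face_class c%:MP * f.

Lemma face_scaleA a b f : face_scale a (face_scale b f) = face_scale (a * b) f.
Proof. by rewrite /face_scale mulrA -rmorphM /= mpolyCM. Qed.
Lemma face_scale1 : left_id 1 face_scale.
Proof. by move=> f; rewrite /face_scale mpolyC1 rmorph1 mul1r. Qed.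
Lemma face_scaleDr : right_distributive face_scale +%R.
Proof. by move=> a f g; rewrite /face_scale mulrDr. Qed.
Lemma face_scaleDl f : {morph face_scale^~ f : a b / a + b}.
Proof. by move=> a b; rewrite /face_scale mpolyCD rmorphD mulrDl. Qed.
HB.instance Definition _ := GRing.Zmodule_isLmodule.Build k face_ring
  face_scaleA face_scale1 face_scaleDr face_scaleDl.

Lemma face_scaleAl (c : k) (f g : face_ring) : c *: (f * g) = c *: f * g.
Proof. exact: mulrA. Qed.
HB.instance Definition _ :=
  GRing.Lmodule_isLalgebra.Build k face_ring face_scaleAl.
HB.instance Definition _ := GRing.Lalgebra_isComAlgebra.Build k face_ring.

Lemma face_class_scalable : scalable face_class.
Proof. by move=> c p; rewrite -mul_mpolyC rmorphM. Qed.
HB.instance Definition _ :=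
  GRing.isScalable.Build k _ _ *:%R face_class face_class_scalable.

Definition xbar (i : 'I_n) : face_ring := face_class 'X_i.

(* Independent of the chosen representative when [m] is supported on a face
   (see [face_coef_class]); meaningless otherwise. *)
Definition face_coef (m : 'X_{1..n}) (f : face_ring) : k := (face_repr f)@_m.

Lemma face_coef_class m p : face_mnm D m -> face_coef m (face_class p) = p@_m.
Proof.
move=> hm; apply/eqP; rewrite -subr_eq0 -mcoeffB; apply/eqP.
by apply: (SR_idealP _).1 hm; apply/face_class_eq; rewrite face_reprK.
Qed.

Lemma face_coef_inj f g :
  (forall m, face_mnm D m -> face_coef m f = face_coef m g) -> f = g.
Proof.
move=> h; rewrite -(face_reprK f) -(face_reprK g); apply/face_class_eq.
by apply/SR_idealP => m hm; rewrite mcoeffB; apply/eqP; rewrite subr_eq0 [_@__]h.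
Qed.

Lemma face_coefD m f g : face_mnm D m ->
  face_coef m (f + g) = face_coef m f + face_coef m g.
Proof.
move=> hm; rewrite -[f]face_reprK -[g]face_reprK -rmorphD.
by rewrite !face_coef_class // mcoeffD.
Qed.

Lemma face_coefZ m c f : face_mnm D m ->
  face_coef m (c *: f) = c * face_coef m f.
Proof.
move=> hm; rewrite -[f]face_reprK -linearZ.
by rewrite !face_coef_class // mcoeffZ.
Qed.

Lemma face_coefM m f g : face_mnm D m ->
  face_coef m (f * g) =
  \sum_(h : 'X_{1..n < (mdeg m).+1, (mdeg m).+1} | m == (h.1 + h.2)%MM)
    face_coef h.1 f * face_coef h.2 g.
Proof.
move=> hm; rewrite -{1}[f]face_reprK -{1}[g]face_reprK -rmorphM.
by rewrite face_coef_class // mcoeffM.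
Qed.

Lemma face_coef0 m : face_mnm D m -> face_coef m 0 = 0.
Proof. by move=> hm; rewrite -(rmorph0 face_class) face_coef_class ?mcoeff0. Qed.

Lemma face_coef_sum m I (r : seq I) (P : pred I) (F : I -> face_ring) :
  face_mnm D m ->
  face_coef m (\sum_(i <- r | P i) F i) = \sum_(i <- r | P i) face_coef m (F i).
Proof.
move=> hm; elim: r => [|i r IH]; first by rewrite !big_nil face_coef0.
by rewrite !big_cons; case: (P i); rewrite ?face_coefD ?IH.
Qed.

Definition degree_le (d : nat) (f : face_ring) : Prop :=
  exists2 p : {mpoly k[n]}, face_class p = f & (msize p <= d.+1)%N.

Lemma degree_leW d e f : (d <= e)%N -> degree_le d f -> degree_le e f.
Proof. by move=> de [p <- hp]; exists p => //; apply: leq_trans hp _. Qed.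

(* The monomial basis of the elements of degree at most d. *)
Definition face_basis (d : nat) := {m : 'X_{1..n < d.+1} | face_mnm D m}.
HB.instance Definition _ d := Finite.on (face_basis d).

Definition face_basis_mnm d (m : face_basis d) : 'X_{1..n} := bmnm (val m).
Coercion face_basis_mnm : face_basis >-> multinom.

End FaceRing.

Section FaceRingTheory.
Variables (k : closedFieldType) (n : nat) (D : simplicial_complex n).
Local Notation A := (face_ring k D).
Implicit Types (f g : A) (m : 'X_{1..n}).

Lemma face_classX m : face_class D 'X_[m] = \prod_i xbar k D i ^+ m i.
Proof. by rewrite mpolyXE_id rmorph_prod; apply: eq_bigr => i _; rewrite rmorphXn. Qed.

Lemma face_coefX m m' : face_mnm D m ->
  face_coef m (face_class D 'X_[m'] : A) = (m' == m)%:R.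
Proof. by move=> hm; rewrite face_coef_class // mcoeffX. Qed.

Lemma face_coef_xbar i m : face_mnm D m ->
  face_coef m (xbar k D i) = (U_(i)%MM == m)%:R.
Proof. exact: face_coefX. Qed.

Lemma nonface_prod (S : {set 'I_n}) : S \notin faces D ->
  \prod_(i in S) xbar k D i = 0.
Proof.
move=> hS; rewrite -rmorph_prod -(rmorph0 (face_class D)).
by apply/face_class_eq; rewrite subr0 SR_gen.
Qed.

Lemma face_basisE d f :
  (forall m, face_mnm D m -> (d < mdeg m)%N -> face_coef m f = 0) ->
  f = \sum_(m : face_basis D d) face_coef m f *: face_class D 'X_[m].
Proof.
move=> h; apply: face_coef_inj => m hm; rewrite face_coef_sum //.
have [md|md] := ltnP d (mdeg m).
  rewrite h // big1 // => m' _; rewrite face_coefZ // face_coefX //.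
  case: eqP => [e|_]; last by rewrite mulr0.
  by have := bmdeg (val m'); rewrite -/(face_basis_mnm m') e ltnS leqNgt md.
have md' : (mdeg m < d.+1)%N by [].
pose m0 : face_basis D d :=
  @exist _ (fun m : 'X_{1..n < d.+1} => face_mnm D m) (BMultinom md') hm.
rewrite (bigD1 m0) //= face_coefZ // face_coefX // eqxx mulr1 big1 ?addr0 //.
move=> m' /eqP m'0; rewrite face_coefZ // face_coefX //.
case: eqP => [e|_]; last by rewrite mulr0.
by case: m'0; do 2!apply: val_inj.
Qed.

Lemma degree_leP d f :
  degree_le d f <->
  (forall m, face_mnm D m -> (d < mdeg m)%N -> face_coef m f = 0).
Proof.
split=> [[p <- hp] m hm dm|h].
  rewrite face_coef_class //; apply: memN_msupp_eq0.
  by apply: msize_mdeg_ge; apply: leq_trans hp _.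
exists (\sum_(m : face_basis D d) face_coef m f *: 'X_[m]).
  rewrite raddf_sum /= [RHS](face_basisE h); apply: eq_bigr => m _.
  by rewrite linearZ.
apply: leq_trans (msize_sum _ _ _) _; apply/bigmax_leqP => m _.
by apply: leq_trans (msizeZ_le _ _) _; rewrite msizeX; apply: (bmdeg (val m)).
Qed.

Lemma degree_le_sum d I (r : seq I) (P : pred I) (F : I -> A) :
  (forall i, P i -> degree_le d (F i)) ->
  degree_le d (\sum_(i <- r | P i) F i).
Proof.
move=> h; apply/degree_leP => m hm dm; rewrite face_coef_sum // big1 // => i Pi.
exact: (degree_leP _ _).1 (h i Pi) _ hm dm.
Qed.

Lemma degree_leZ d c f : degree_le d f -> degree_le d (c *: f).
Proof.
move=> /degree_leP h; apply/degree_leP => m hm dm.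
by rewrite face_coefZ // h ?mulr0.
Qed.

Lemma degree_leM d e f g : degree_le d f -> degree_le e g ->
  degree_le (d + e) (f * g).
Proof.
move=> [p <- hp] [q <- hq]; exists (p * q); rewrite ?rmorphM //.
have [->|p0] := eqVneq p 0; first by rewrite mul0r msize0.
have [->|q0] := eqVneq q 0; first by rewrite mulr0 msize0.
by rewrite msizeM //; move: hp hq; set a := mmeasure _ p; set b := mmeasure _ q; lia.
Qed.

Lemma degree_le1 d : degree_le d (1 : A).
Proof. by exists 1; rewrite ?rmorph1 // msize1. Qed.

Lemma degree_leX d f e : degree_le d f -> degree_le (d * e) (f ^+ e).
Proof.
move=> h; elim: e => [|e IH]; first exact: degree_le1.
by rewrite exprS mulnS; apply: degree_leM.
Qed.

Lemma degree_le_mon d e (F : 'I_n -> A) m : (mdeg m <= e)%N ->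
  (forall i, degree_le d (F i)) -> degree_le (d * e) (\prod_i F i ^+ m i).
Proof.
move=> me h; apply: degree_leW (leq_mul (leqnn d) me) _.
rewrite mdegE big_distrr /=.
elim: (index_enum _) => [|i r IH]; first by rewrite !big_nil; apply: degree_le1.
by rewrite !big_cons; apply: degree_leM IH; apply: degree_leX.
Qed.

Lemma lrmorph_expand d f (phi : {lrmorphism A -> A}) : degree_le d f ->
  phi f = \sum_(m : face_basis D d)
            face_coef m f *: \prod_i phi (xbar k D i) ^+ m i.
Proof.
move=> /degree_leP/face_basisE {1}->; rewrite linear_sum; apply: eq_bigr => m _ /=.
rewrite linearZ face_classX rmorph_prod; congr (_ *: _).
by apply: eq_bigr => i _; rewrite rmorphXn.
Qed.

Lemma degree_le_ex f : exists d, degree_le d f.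
Proof.
exists (msize (face_repr f)), (face_repr f) => //; exact: face_reprK.
Qed.

Lemma lrmorph_ext (phi psi : {lrmorphism A -> A}) :
  (forall i, phi (xbar k D i) = psi (xbar k D i)) -> phi =1 psi.
Proof.
move=> h f; have [d hd] := degree_le_ex f.
rewrite !(lrmorph_expand _ hd); apply: eq_bigr => m _; congr (_ *: _).
by apply: eq_bigr => i _; rewrite h.
Qed.

Definition face_ev (F : 'I_n -> A) (p : {mpoly k[n]}) : A :=
  mmap (in_alg A) F p.

Lemma face_ev_zmod F : zmod_morphism (face_ev F).
Proof. by move=> p q; apply: mmapB. Qed.
Lemma face_ev_monoid F : monoid_morphism (face_ev F).
Proof.
have [h1 h2] := mmap_is_multiplicative F (in_alg A : {rmorphism k -> A}).
by split.
Qed.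
HB.instance Definition _ F :=
  GRing.isZmodMorphism.Build _ _ (face_ev F) (face_ev_zmod F).
HB.instance Definition _ F :=
  GRing.isMonoidMorphism.Build _ _ (face_ev F) (face_ev_monoid F).

Lemma face_evXU F i : face_ev F 'X_i = F i.
Proof. by rewrite /face_ev mmapX mmap1U. Qed.

Lemma face_evZ F c p : face_ev F (c *: p) = c *: face_ev F p.
Proof. by rewrite /face_ev mmapZ /= mulr_algl. Qed.

Section FaceHom.
Variable F : 'I_n -> A.
Hypothesis F_rel : forall S : {set 'I_n}, S \notin faces D ->
  \prod_(i in S) F i = 0.

Definition face_hom_fun (f : A) : A := face_ev F (face_repr f).

Lemma face_hom_class p : face_hom_fun (face_class D p) = face_ev F p.
Proof.
apply/eqP; rewrite -subr_eq0 -raddfB /=.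
have /asboolP[c ->] : face_repr (face_class D p) - p \in SR_ideal D.
  by apply/face_class_eq; rewrite face_reprK.
rewrite rmorph_sum big1 // => S hS; rewrite rmorphM rmorph_prod /=.
under [X in _ * X]eq_bigr => i _ do rewrite face_evXU.
by rewrite F_rel // mulr0.
Qed.

Lemma face_hom_zmod : zmod_morphism face_hom_fun.
Proof.
move=> f g; rewrite -[f]face_reprK -[g]face_reprK -raddfB.
by rewrite !face_hom_class raddfB.
Qed.

Lemma face_hom_monoid : monoid_morphism face_hom_fun.
Proof.
split=> [|f g]; first by rewrite -[X in face_hom_fun X](rmorph1 (face_class D)) face_hom_class rmorph1.
rewrite -[f]face_reprK -[g]face_reprK -rmorphM.
by rewrite !face_hom_class rmorphM.
Qed.

Lemma face_hom_scalable : scalable face_hom_fun.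
Proof.
move=> c f; rewrite -[f]face_reprK -linearZ !face_hom_class.
exact: face_evZ.
Qed.

Definition face_hom : {lrmorphism A -> A} :=
  HB.pack face_hom_fun
    (GRing.isZmodMorphism.Build _ _ face_hom_fun face_hom_zmod)
    (GRing.isMonoidMorphism.Build _ _ face_hom_fun face_hom_monoid)
    (GRing.isScalable.Build k _ _ *:%R face_hom_fun face_hom_scalable).

Lemma face_hom_xbar i : face_hom (xbar k D i) = F i.
Proof. by rewrite /= face_hom_class face_evXU. Qed.

End FaceHom.

Section FaceRegular.
Variables (V : Type) (X : affine_variety k V).

Definition face_regular (F : V -> A) : Prop :=
  forall m, face_mnm D m -> regular X (fun x => face_coef m (F x)).

Lemma eq_face_regular F G : (forall x, X x -> F x = G x) ->
  face_regular F -> face_regular G.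
Proof.
by move=> e h m hm; apply: eq_regular (h m hm) => x Xx; rewrite e.
Qed.

Lemma face_regular_cst f : face_regular (fun=> f).
Proof. by move=> m _; apply: regular_cst. Qed.

Lemma face_regularM F G : face_regular F -> face_regular G ->
  face_regular (fun x => F x * G x).
Proof.
move=> hF hG m hm.
apply: eq_regular; first by move=> x _; symmetry; apply: face_coefM.
apply: regular_sum => -[m1 m2] /= /eqP e.
have [h1 h2] : face_mnm D m1 /\ face_mnm D m2 by apply: face_mnmD; rewrite -e.
by apply: regularM; [apply: hF | apply: hG].
Qed.

Lemma face_regularZ c F : regular X c -> face_regular F ->
  face_regular (fun x => c x *: F x).
Proof.
move=> hc hF m hm.
apply: (@eq_regular _ _ _ (fun x => c x * face_coef m (F x))).
  by move=> x _; rewrite face_coefZ.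
by apply: regularM; last apply: hF.
Qed.

Lemma face_regular_sum I (r : seq I) (P : pred I) (F : I -> V -> A) :
  (forall i, P i -> face_regular (F i)) ->
  face_regular (fun x => \sum_(i <- r | P i) F i x).
Proof.
move=> h m hm; apply: (@eq_regular _ _ _
  (fun x => \sum_(i <- r | P i) face_coef m (F i x))).
  by move=> x _ /=; rewrite face_coef_sum.
by apply: regular_sum => i Pi; apply: (h i Pi m hm).
Qed.

Lemma face_regularB F G : face_regular F -> face_regular G ->
  face_regular (fun x => F x - G x).
Proof.
move=> hF hG m hm.
apply: (@eq_regular _ _ _ (fun x => face_coef m (F x) - face_coef m (G x))).
  by move=> x _; rewrite -scaleN1r face_coefD // face_coefZ // mulN1r.
by apply: regularB; [apply: hF | apply: hG].
Qed.

Lemma face_regular_prod I (r : seq I) (P : pred I) (F : I -> V -> A) :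
  (forall i, P i -> face_regular (F i)) ->
  face_regular (fun x => \prod_(i <- r | P i) F i x).
Proof.
move=> h; elim: r => [|i r IH].
  by apply: eq_face_regular (face_regular_cst 1) => x _; rewrite big_nil.
case Pi: (P i).
  apply: eq_face_regular (face_regularM (h i Pi) IH) => x _.
  by rewrite big_cons Pi.
by apply: eq_face_regular IH => x _; rewrite big_cons Pi.
Qed.

Lemma face_regularX F e : face_regular F -> face_regular (fun x => F x ^+ e).
Proof.
move=> h; elim: e => [|e IH].
  by apply: eq_face_regular (face_regular_cst 1) => x _; rewrite expr0.
by apply: eq_face_regular (face_regularM h IH) => x _; rewrite exprS.
Qed.

End FaceRegular.

End FaceRingTheory.

Section FaceAutomorphisms.
Variables (k : closedFieldType) (n : nat) (D : simplicial_complex n).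
Local Notation A := (face_ring k D).
Local Notation x := (xbar k D).

Record face_aut := FaceAut {
  aut_fun :> {lrmorphism A -> A};
  aut_inv : {lrmorphism A -> A};
  aut_funK : cancel aut_fun aut_inv;
  aut_invK : cancel aut_inv aut_fun }.

Lemma lrmorphism_eq (f g : {lrmorphism A -> A}) : f =1 g -> f = g.
Proof.
case: f g => [f [[c1] [c2] [c3]]] [g [[d1] [d2] [d3]]] /= /funext e.
by case: _ / e d1 d2 d3 => d1 d2 d3; congr (GRing.LRMorphism.Pack
  (GRing.LRMorphism.Class _ _ _)); congr (_ _); apply: Prop_irrelevance.
Qed.

Lemma face_aut_eq (phi psi : face_aut) : phi =1 psi -> phi = psi.
Proof.
case: phi psi => [f g fK gK] [f' g' fK' gK'] /= e.
have {}e := lrmorphism_eq e; subst f'.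
have e : g = g'.
  by apply: lrmorphism_eq => a; rewrite -[a in LHS]gK' fK.
by subst g'; congr FaceAut; apply: Prop_irrelevance.
Qed.

Lemma face_aut_ext (phi psi : face_aut) :
  (forall i, phi (x i) = psi (x i)) -> phi = psi.
Proof. by move=> h; apply: face_aut_eq; apply: lrmorph_ext. Qed.

HB.instance Definition _ := gen_eqMixin face_aut.
HB.instance Definition _ := gen_choiceMixin face_aut.

Definition face_aut_one : face_aut :=
  @FaceAut idfun idfun (fun=> erefl) (fun=> erefl).

Definition face_aut_inv (phi : face_aut) : face_aut :=
  FaceAut (aut_invK phi) (aut_funK phi).

(* The group law is the composition of algebra automorphisms, so that a
   conjugate t * e * t^-1 sends f to t (e (t^-1 f)). *)
Definition face_aut_mul (phi psi : face_aut) : face_aut :=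
  @FaceAut (aut_fun phi \o aut_fun psi) (aut_inv psi \o aut_inv phi)
    (can_comp (aut_funK phi) (aut_funK psi))
    (can_comp (aut_invK psi) (aut_invK phi)).

Lemma face_aut_mulA : associative face_aut_mul.
Proof. by move=> f g h; apply: face_aut_eq. Qed.
Lemma face_aut_mul1 : left_id face_aut_one face_aut_mul.
Proof. by move=> f; apply: face_aut_eq. Qed.
Lemma face_aut_mulr1 : right_id face_aut_one face_aut_mul.
Proof. by move=> f; apply: face_aut_eq. Qed.
Lemma face_aut_mulV : left_inverse face_aut_one face_aut_inv face_aut_mul.
Proof. by move=> f; apply: face_aut_eq => a /=; apply: aut_funK. Qed.
Lemma face_aut_mulrV : right_inverse face_aut_one face_aut_inv face_aut_mul.
Proof. by move=> f; apply: face_aut_eq => a /=; apply: aut_invK. Qed.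
HB.instance Definition _ := isGroup.Build face_aut face_aut_mulA
  face_aut_mul1 face_aut_mulr1 face_aut_mulV face_aut_mulrV.

(* As a point of an affine space, [phi] is the pair (phi, phi^-1), each member
   being given by the coefficients of the images of the variables. *)
Definition aut_side (phi : face_aut) (b : bool) : {lrmorphism A -> A} :=
  if b then aut_fun phi else aut_inv phi.

Definition aut_degree_le (d : nat) (phi : face_aut) : Prop :=
  forall b l, degree_le d (aut_side phi b (x l)).

Definition aut_coord (d : nat) (phi : face_aut)
  (j : bool * 'I_n * face_basis D d) : k :=
  face_coef j.2 (aut_side phi j.1.1 (x j.1.2)).

Lemma aut_coord_inj d phi psi : aut_degree_le d phi -> aut_degree_le d psi ->
  aut_coord phi =1 @aut_coord d psi -> phi = psi.
Proof.
move=> hphi hpsi e; apply: face_aut_ext => l.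
have := (degree_leP _ _).1 (hphi true l); move/face_basisE => /= ->.
have := (degree_leP _ _).1 (hpsi true l); move/face_basisE => /= ->.
by apply: eq_bigr => m _; congr (_ *: _); apply: (e (true, l, m)).
Qed.

Section Closed.
Variable d : nat.
Local Notation ix := (bool * 'I_n * face_basis D d)%type.

Definition coord_aut (v : ix -> k) (b : bool) (l : 'I_n) : A :=
  \sum_(m : face_basis D d) v (b, l, m) *: face_class D 'X_[m].

Lemma coord_aut_regular b l :
  face_regular (affine_space k ix) (fun v => coord_aut v b l).
Proof.
apply: face_regular_sum => m _; apply: face_regularZ; last first.
  exact: face_regular_cst.
exact: regular_proj.
Qed.

Lemma coord_aut_coef v b l (m : face_basis D d) :
  face_coef m (coord_aut v b l) = v (b, l, m).
Proof.
have hm : face_mnm D m := valP m.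
rewrite face_coef_sum // (bigD1 m) //= face_coefZ // face_coefX // eqxx mulr1.
rewrite big1 ?addr0 // => m' /eqP m'm; rewrite face_coefZ // face_coefX //.
case: eqP => [e|_]; last by rewrite mulr0.
by case: m'm; do 2!apply: val_inj.
Qed.

Lemma coord_aut_degree v b l : degree_le d (coord_aut v b l).
Proof.
apply: degree_le_sum => m _; apply: degree_leZ.
by exists 'X_[face_basis_mnm m] => //; rewrite msizeX; exact: bmdeg (val m).
Qed.

Lemma coord_autE (phi : face_aut) b l : aut_degree_le d phi ->
  coord_aut (aut_coord phi) b l = aut_side phi b (x l).
Proof.
by move=> h; symmetry; apply/face_basisE/degree_leP.
Qed.

Lemma eq_coord_aut v w b l : v =1 w -> coord_aut v b l = coord_aut w b l.
Proof. by move=> e; apply: eq_bigr => m _; rewrite e. Qed.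

Lemma aut_sideK phi b f : aut_side phi (~~ b) (aut_side phi b f) = f.
Proof. by case: b; [apply: aut_funK | apply: aut_invK]. Qed.

Definition aut_eqn (f : (ix -> k) -> k) : Prop :=
  (exists b (S : {set 'I_n}) m, [/\ S \notin faces D, face_mnm D m
     & f = fun v => face_coef m (\prod_(i in S) coord_aut v b i)]) \/
  (exists b l m, face_mnm D m /\
     f = fun v => face_coef m
       (\sum_(m' : face_basis D d)
          v (b, l, m') *: \prod_i coord_aut v (~~ b) i ^+ m' i - x l)).

Lemma aut_eqn_regular f : aut_eqn f -> regular (affine_space k ix) f.
Proof.
case=> [[b [S [m [_ hm ->]]]]|[b [l [m [hm ->]]]]].
  by move: m hm; apply: face_regular_prod => i _; apply: coord_aut_regular.
move: m hm; apply: face_regularB; last exact: face_regular_cst.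
apply: face_regular_sum => m' _; apply: face_regularZ.
  exact: regular_proj.
by apply: face_regular_prod => i _; apply/face_regularX/coord_aut_regular.
Qed.

Lemma aut_coord_closed : exists E, forall v,
  zero_locus E v <->
  exists2 phi, aut_degree_le d phi & @aut_coord d phi =1 v.
Proof.
apply: (closed_image_by aut_eqn_regular) => v; split=> [h|[phi hphi e] f].
  have rel b (S : {set 'I_n}) : S \notin faces D ->
      \prod_(i in S) coord_aut v b i = 0.
    move=> hS; apply: face_coef_inj => m hm; rewrite face_coef0 //.
    by apply: (h (fun v => face_coef m _)); left; exists b, S, m.
  have [F FE] : exists F : bool -> {lrmorphism A -> A},
      forall b l, F b (x l) = coord_aut v b l.
    by exists (fun b => face_hom (rel b)) => b l; apply: face_hom_xbar.
  have FK b : cancel (F b) (F (~~ b)).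
    apply: (lrmorph_ext (phi := F (~~ b) \o F b) (psi := idfun)) => l.
    rewrite /= FE linear_sum; apply/eqP; rewrite -subr_eq0; apply/eqP.
    apply: face_coef_inj => m hm; rewrite face_coef0 //.
    rewrite -[RHS](h (fun v => face_coef m
      (\sum_(m' : face_basis D d)
          v (b, l, m') *: \prod_i coord_aut v (~~ b) i ^+ m' i - x l))).
      congr (face_coef _ (_ - _)); apply: eq_bigr => m' _ /=.
      rewrite linearZ face_classX rmorph_prod; congr (_ *: _).
      by apply: eq_bigr => i _; rewrite rmorphXn /= FE.
    by right; exists b, l, m.
  pose phi := FaceAut (FK true) (FK false).
  have sideE b l : aut_side phi b (x l) = coord_aut v b l.
    by case: b; apply: FE.
  exists phi; first by move=> b l; rewrite sideE; apply: coord_aut_degree.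
  by move=> [[b l] m]; rewrite /aut_coord sideE coord_aut_coef.
have vE b l : coord_aut v b l = aut_side phi b (x l).
  by rewrite -(eq_coord_aut b l e) coord_autE.
case=> [[b [S [m [hS hm ->]]]]|[b [l [m [hm ->]]]]].
  under eq_bigr => i _ do rewrite vE.
  by rewrite -rmorph_prod nonface_prod // rmorph0 face_coef0.
rewrite -(face_coef0 k hm); congr face_coef.
rewrite -[X in _ - X](aut_sideK phi b) (lrmorph_expand _ (hphi b l)).
apply/eqP; rewrite subr_eq0; apply/eqP; apply: eq_bigr => m' _.
rewrite -e; congr (_ *: _); apply: eq_bigr => i _; congr (_ ^+ _).
exact: vE.
Qed.

End Closed.

Definition aut_piece (d : nat) : affine_variety k face_aut :=
  AffineVariety (@aut_coord_inj d) (@aut_coord_closed d).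

Lemma aut_side_regular d b l :
  face_regular (aut_piece d) (fun phi => aut_side phi b (x l)).
Proof.
move=> m hm; have [md|md] := ltnP d (mdeg m).
  apply: eq_regular (regular_cst _ 0) => phi /(_ b l)/degree_leP h.
  by rewrite h.
have md' : (mdeg m < d.+1)%N by [].
pose m0 : face_basis D d :=
  @exist _ (fun m : 'X_{1..n < d.+1} => face_mnm D m) (BMultinom md') hm.
exact: (@regular_coord _ _ (aut_piece d) (b, l, m0)).
Qed.

Lemma aut_cover (phi : face_aut) : exists d, aut_piece d phi.
Proof.
have /choice[e he] : forall bl : bool * 'I_n,
    exists d, degree_le d (aut_side phi bl.1 (x bl.2)).
  by move=> bl; apply: degree_le_ex.
exists (\max_bl e bl)%N => b l; apply: degree_leW (he (b, l)).
exact: leq_bigmax.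
Qed.

Lemma aut_incl d : closed_immersion (aut_piece d) (aut_piece d.+1) id.
Proof.
have hZ : closed_in (aut_piece d.+1)
    (fun psi => exists2 phi, aut_piece d phi & psi = id phi).
  apply: (closed_by (F := fun f => exists b l (m : face_basis D d.+1),
    mdeg m = d.+1 /\ f = fun phi => face_coef m (aut_side phi b (x l)))).
    by move=> f [b [l [m [_ ->]]]]; apply: aut_side_regular; apply: (valP m).
  move=> phi; split=> [[psi hphi ->]|[hphi h]].
    split=> [b l|f [b [l [m [md ->]]]]]; first exact: degree_leW (hphi b l).
    by apply: (degree_leP _ _).1 (hphi b l) _ (valP m) _; rewrite md.
  exists phi => // b l; apply/degree_leP => m hm.
  rewrite leq_eqVlt => /orP[/eqP md|]; last first.
    exact: (degree_leP _ _).1 (hphi b l) _ hm.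
  have md' : (mdeg m < d.+2)%N by rewrite -md.
  pose m0 : face_basis D d.+1 :=
    @exist _ (fun m : 'X_{1..n < d.+2} => face_mnm D m) (BMultinom md') hm.
  by apply: (h (fun phi => face_coef m _)); exists b, l, m0.
exists hZ; split.
  split=> [phi hphi|[[b l] m]]; first by exists phi.
  by apply: aut_side_regular; apply: (valP m).
exists id; split=> //; split=> [_ [phi hphi ->]//|[[b l] m]].
by apply: regular_sub; apply: aut_side_regular; apply: (valP m).
Qed.

Lemma aut_side_mul (phi psi : face_aut) b f :
  aut_side (phi * psi)%g b f =
  if b then aut_fun phi (aut_fun psi f) else aut_inv psi (aut_inv phi f).
Proof. by case: b. Qed.

Lemma aut_ind_mul d : exists e,
  morphism (product (aut_piece d) (aut_piece d)) (aut_piece e)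
    (fun gh => (gh.1 * gh.2)%g).
Proof.
have expand (f g : face_aut) b b' l :
    aut_piece d f -> aut_piece d g ->
    aut_side f b (aut_side g b' (x l)) = \sum_(m : face_basis D d)
      face_coef m (aut_side g b' (x l)) *:
      \prod_i aut_side f b (x i) ^+ m i.
  by move=> hf hg; apply: lrmorph_expand.
exists (d * d)%N; split=> [[f g] /= [hf hg] b l|[[b l] m]].
  have deg (f' g' : face_aut) b' b'' : aut_piece d f' -> aut_piece d g' ->
      degree_le (d * d) (aut_side f' b' (aut_side g' b'' (x l))).
    move=> hf' hg'; rewrite expand //; apply: degree_le_sum => m _.
    apply: degree_leZ; apply: degree_le_mon => [|i]; last exact: hf'.
    exact: bmdeg (val m).
  by rewrite aut_side_mul; case: b; [apply: (deg f g true true)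
    | apply: (deg g f false false)].
have hm : face_mnm D (face_basis_mnm m) := valP m.
have reg b' b'' (P := product (aut_piece d) (aut_piece d)) (p q : _ -> face_aut) :
    morphism P (aut_piece d) p -> morphism P (aut_piece d) q ->
    regular P (fun gh => face_coef (face_basis_mnm m)
      (aut_side (p gh) b' (aut_side (q gh) b'' (x l)))).
  move=> hp hq; apply: (@eq_regular _ _ _ (fun gh => face_coef (face_basis_mnm m)
    (\sum_(m' : face_basis D d) face_coef m' (aut_side (q gh) b'' (x l)) *:
      \prod_i aut_side (p gh) b' (x i) ^+ m' i))).
    by move=> gh Pgh; rewrite expand //; [apply: hp.1 | apply: hq.1].
  move: (face_basis_mnm m) hm; apply: face_regular_sum => m' _.
  apply: face_regularZ.
    exact: (regular_comp hq (aut_side_regular d b'' l (valP m'))).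
  apply: face_regular_prod => i _; apply: face_regularX => m'' hm''.
  exact: (regular_comp hp (aut_side_regular d b' i hm'')).
case: b.
  exact: (reg true true _ _ (morphism_fst _ _) (morphism_snd _ _)).
exact: (reg false false _ _ (morphism_snd _ _) (morphism_fst _ _)).
Qed.

Lemma aut_side_inv (phi : face_aut) b : aut_side (phi^-1)%g b = aut_side phi (~~ b).
Proof. by case: b. Qed.

Lemma aut_ind_inv d : exists e,
  morphism (aut_piece d) (aut_piece e) (fun g => (g^-1)%g).
Proof.
exists d; split=> [phi hphi b l|[[b l] m]]; first by rewrite aut_side_inv.
apply: eq_regular (aut_side_regular d (~~ b) l (valP m)) => phi _.
by rewrite /= /aut_coord /= aut_side_inv.
Qed.

Definition Aut_X : ind_group k :=
  IndGroup aut_cover aut_incl aut_ind_mul aut_ind_inv.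

End FaceAutomorphisms.

Section StandardTorus.
Variables (k : closedFieldType) (n : nat) (D : simplicial_complex n).
Local Notation A := (face_ring k D).
Local Notation x := (xbar k D).
Local Notation G := (Aut_X k D).

Definition torus_elt (t : 'I_n -> k) (phi : G) : Prop :=
  (forall i, t i != 0) /\ (forall i, aut_fun phi (x i) = t i *: x i).

Definition T0_set (phi : G) : Prop := exists t, torus_elt t phi.

(* If [phi] is the action of [t] on the variables, this is [t i]. *)
Definition torus_param (phi : G) (i : 'I_n) : k :=
  face_coef U_(i)%MM (aut_fun phi (x i)).

Lemma torus_paramE t phi : torus_elt t phi -> torus_param phi =1 t.
Proof.
have hU i : face_mnm D U_(i)%MM := face_mnmU D i.
move=> [_ h] i; rewrite /torus_param h face_coefZ // face_coef_xbar //.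
by rewrite eqxx mulr1.
Qed.

Lemma torus_elt_side t phi b i : torus_elt t phi ->
  aut_side phi b (x i) = Gm_coord (t i) b *: x i.
Proof.
move=> [t0 h]; case: b => //=; apply: (scalerI (t0 i)).
by rewrite scalerA divff // scale1r -linearZ -h; apply: aut_funK.
Qed.

Lemma torus_elt1 : torus_elt (fun=> 1) 1%g.
Proof. by split=> i; rewrite ?oner_eq0 // scale1r. Qed.

Lemma torus_eltM s t phi psi : torus_elt s phi -> torus_elt t psi ->
  torus_elt (fun i => s i * t i) (phi * psi)%g.
Proof.
move=> [s0 hs] [t0 ht]; split=> i; first by rewrite mulf_neq0.
by rewrite /= ht linearZ /= hs scalerA mulrC.
Qed.

Lemma torus_eltV t phi : torus_elt t phi ->
  torus_elt (fun i => (t i)^-1) (phi^-1)%g.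
Proof.
move=> h; split=> i; first by rewrite invr_eq0; apply: h.1.
exact: (torus_elt_side false i h).
Qed.

Lemma torus_elt_inj t phi psi : torus_elt t phi -> torus_elt t psi -> phi = psi.
Proof. by move=> [_ h] [_ h']; apply: face_aut_ext => i; rewrite h h'. Qed.

Lemma torus_elt_ex t : (forall i, t i != 0) -> exists phi, torus_elt t phi.
Proof.
move=> t0.
have rel (s : 'I_n -> k) (S : {set 'I_n}) : S \notin faces D ->
    \prod_(i in S) (s i *: x i) = 0.
  by move=> hS; rewrite scaler_prod nonface_prod // scaler0.
have [F FE] : exists F : ('I_n -> k) -> {lrmorphism A -> A},
    forall s i, F s (x i) = s i *: x i.
  by exists (fun s => face_hom (rel s)) => s i; apply: face_hom_xbar.
have FK s s' : (forall i, s i * s' i = 1) -> cancel (F s) (F s').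
  move=> h; apply: (lrmorph_ext (phi := F s' \o F s) (psi := idfun)) => i.
  by rewrite /= FE linearZ /= FE scalerA h scale1r.
have h1 i : t i * (t i)^-1 = 1 by rewrite divff.
have h2 i : (t i)^-1 * t i = 1 by rewrite mulVf.
by exists (FaceAut (FK _ _ h1) (FK _ _ h2)); split=> // i; apply: FE.
Qed.

Lemma T0_closed : closed_in (piece G 1) T0_set.
Proof.
apply: (closed_by (F := fun f => exists b l m,
  [/\ face_mnm D m, m != U_(l)%MM
    & f = fun phi => face_coef m (aut_side phi b (x l))])).
  by move=> f [b [l [m [hm _ ->]]]]; apply: aut_side_regular.
move=> phi; split=> [[t ht]|[_ h]].
  split=> [b l|f [b [l [m [hm ml ->]]]]].
    rewrite (torus_elt_side b l ht); apply: degree_leZ.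
    by exists 'X_l => //; rewrite msizeX mdeg1.
  rewrite (torus_elt_side b l ht) face_coefZ // face_coef_xbar //.
  by rewrite eq_sym (negPf ml) mulr0.
pose c b l := face_coef U_(l)%MM (aut_side phi b (x l)).
have hc b l : aut_side phi b (x l) = c b l *: x l.
  apply: face_coef_inj => m hm; rewrite face_coefZ // face_coef_xbar // eq_sym.
  have [->|ml] := eqVneq m U_(l)%MM; first by rewrite mulr1.
  by rewrite mulr0; apply: (h (fun phi => face_coef m _)); exists b, l, m.
have x0 l : x l != 0.
  apply/eqP => /(congr1 (face_coef U_(l)%MM)).
  have hU := face_mnmU D l.
  rewrite face_coef_xbar // face_coef0 // eqxx => /eqP.
  by rewrite oner_eq0.
exists (c true); split=> l; last exact: (hc true).
apply: contraNneq (x0 l) => cl0.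
by rewrite -[x l](aut_sideK phi true) hc cl0 scale0r linear0.
Qed.

Definition T0_asg : algebraic_subgroup G.
Proof.
apply: (AlgebraicSubgroup T0_closed).
- by exists (fun=> 1); apply: torus_elt1.
- by move=> g h [s hs] [t ht]; eexists; apply: torus_eltM hs ht.
- by move=> g [t ht]; eexists; apply: torus_eltV ht.
Defined.

Lemma torus_side_regular b i :
  regular T0_asg (fun phi => Gm_coord (torus_param phi i) b).
Proof.
apply: (@eq_regular _ _ _
  (fun phi => face_coef U_(i)%MM (aut_side phi b (x i)))).
  have hU := face_mnmU D i.
  move=> phi [t ht]; rewrite (torus_elt_side b i ht) (torus_paramE ht).
  by rewrite face_coefZ // face_coef_xbar // eqxx mulr1.
by apply: regular_sub; apply: aut_side_regular; apply: face_mnmU.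
Qed.

Lemma T0_iso : exists m (e : ('I_m -> k) -> G),
    isomorphism (std_torus k m) T0_asg e /\
    forall s t, std_torus k m s -> std_torus k m t ->
      e (fun i => s i * t i) = (e s * e t)%g.
Proof.
have /choice[e he] : forall t : 'I_n -> k, exists phi : G,
    (forall i, t i != 0) -> torus_elt t phi.
  move=> t; case: (pselect (forall i, t i != 0)) => [t0|t0].
    by have [phi hphi] := torus_elt_ex t0; exists phi.
  by exists 1%g.
exists n, e; split; last first.
  move=> s t hs ht; apply: (@torus_elt_inj (fun i => s i * t i)).
    by apply: he => i; rewrite mulf_neq0.
  exact: torus_eltM (he s hs) (he t ht).
split.
  split=> [t ht|[[b l] m]]; first by exists t; apply: he.
  apply: (@eq_regular _ _ _ (fun t => std_torus_coord t (l, b) *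
                                      face_coef (face_basis_mnm m) (x l))).
    have hm : face_mnm D (face_basis_mnm m) := valP m.
    move=> t ht; rewrite /= /aut_coord /= (torus_elt_side b l (he t ht)).
    by rewrite face_coefZ.
  apply: regularM; last exact: regular_cst.
  exact: (@regular_coord _ _ (std_torus k n)).
exists torus_param; split.
- split=> [phi [t ht] i|[i b]]; first by rewrite (torus_paramE ht) ht.1.
  exact: torus_side_regular.
- by move=> t ht; apply: funext; apply: torus_paramE; apply: he.
- move=> phi [t ht]; have -> : torus_param phi = t.
    by apply: funext; apply: torus_paramE.
  exact: torus_elt_inj (he t ht.1) ht.
Qed.

Definition T0 : torus G := Torus T0_iso.

Definition monomial_fun (a : 'rV[int]_n) (phi : G) : k :=
  \prod_i torus_param phi i ^ a 0 i.

Lemma monomial_funE a t phi : torus_elt t phi ->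
  monomial_fun a phi = \prod_i t i ^ a 0 i.
Proof. by move=> ht; apply: eq_bigr => i _; rewrite (torus_paramE ht). Qed.

Lemma monomial_regular a : regular T0_asg (monomial_fun a).
Proof.
apply: regular_prod => i _; case: (a 0 i) => e.
  by apply: regular_exp; apply: (torus_side_regular true).
apply: (@eq_regular _ _ _ (fun phi => Gm_coord (torus_param phi i) false ^+ e.+1)).
  by move=> phi _; rewrite /= exprVn.
by apply: regular_exp; apply: (torus_side_regular false).
Qed.

Lemma monomialV a phi : (monomial_fun a phi)^-1 = monomial_fun (- a) phi.
Proof.
rewrite /monomial_fun -prodfV; apply: eq_bigr => i _.
by rewrite mxE invr_expz.
Qed.

Lemma monomial_morph a : morphism T0 (Gm k) (monomial_fun a).
Proof.
split=> [phi [t ht]|[]].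
- rewrite (monomial_funE a ht); apply/prodf_neq0 => i _.
  by rewrite expfz_neq0 //; apply: ht.1.
- exact: monomial_regular.
apply: eq_regular (monomial_regular (- a)) => phi _.
by rewrite -monomialV.
Qed.

Lemma monomial_mul a phi psi : T0 phi -> T0 psi ->
  monomial_fun a (phi * psi)%g = monomial_fun a phi * monomial_fun a psi.
Proof.
move=> [s hs] [t ht]; rewrite (monomial_funE a (torus_eltM hs ht)).
rewrite (monomial_funE a hs) (monomial_funE a ht) -big_split /=.
by apply: eq_bigr => i _; rewrite expfzMl.
Qed.

(* The character t |-> t^a of T0 (see [monomial_funE]). *)
Definition monomial_character (a : 'rV[int]_n) : character T0 :=
  Character (monomial_morph a) (@monomial_mul a).

End StandardTorus.

(* Main.v *)
Require Import Defs.
From mathcomp Require Import all_boot all_order all_algebra.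
From mathcomp Require Import mpoly boolp zify.

(** Let x_i denote the classes of the variables. The torus acts on the monomials
    supported on faces, which form a basis of the face ring, by pairwise
    distinct characters; everything is read off the coefficients, on this
    basis, of the images of the x_l under the elements of a root subgroup.

    Every Demazure root b - e_i is a weight: the shear
    x_i |-> x_i + s x^b, x_j |-> x_j for j <> i, respects the relations of the
    face ring precisely because i lies in every facet containing supp(b)
    ([shear_rel]), shears compose additively in s as b_i = 0, and conjugation by
    t multiplies s by t^b / t_i ([shear_conj]).

    Conversely let e : Ga -> U parametrise a root subgroup of weight alpha. The
    coefficient of x^m in e(s)(x_l) is a polynomial p in s, and the conjugation
    rule says that p(alpha(t) s) = (t^m / t_l) p(s); so alpha^r = t^m / t_l as
    soon as s^r occurs in p ([weight_power]). In characteristic zero some such p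
    has a linear term ([linear_term_exists]): this is the fact that e is
    generated by its derivative at 0. Hence alpha = t^m / t_l for some face
    monomial x^m occurring in some e(s)(x_l), and two things remain.

    - l lies in cl(supp(m)) ([monomial_supp_closure]). Let F be a face
      containing supp(m). If F together with l were not a face, the product of
      x_l and of the x_j, j in F, would vanish, hence so would its image under
      e(s). But setting the variables outside F to zero is a homomorphism onto
      a polynomial ring, a domain, and for a general s it kills neither
      e(s)(x_l), where x^m occurs, nor e(s)(x_j), where x_j occurs.

    - m_l = 0 ([weight_not_effective]). Otherwise alpha is a nontrivial
      monomial with nonnegative exponents, and every e(s)(x_l) is divisible by
      x_l, since the weights of its terms are multiples of alpha
      ([orbit_dvd]). Applying e(s) to e(-s)(x_l) = x_l g shows that e(s)(x_l)
      divides x_l; restricted to the face supp(m) this is a divisibility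
      between polynomials, of which the divisor contains x^m, of degree at
      least 2. *)

Set Implicit Arguments.
Unset Strict Implicit.
Unset Printing Implicit Defensive.

Import GRing.Theory.
Local Open Scope ring_scope.

(** * Polynomial functions on the line and on a cuspidal cubic *)

Section PolynomialFunctions.
Variable k : closedFieldType.

Lemma polyval_horner (J : finType) (h : J -> {poly k}) (q : {mpoly k[#|J|]}) s :
  polyval q (fun j => (h j).[s]) = (mmap polyC (fun i => h (enum_val i)) q).[s].
Proof.
rewrite /polyval mevalE /mmap horner_sum; apply: eq_bigr => m _.
rewrite hornerM hornerC horner_prod; congr (_ * _).
by apply: eq_bigr => i _; rewrite horner_exp.
Qed.

Lemma regular_Ga f : regular (Ga k) f -> exists p : {poly k}, f = horner p.
Proof.
move=> [q fq]; exists (mmap polyC (fun=> 'X) q); apply: funext => s.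
rewrite fq //; rewrite -(@polyval_horner unit (fun=> 'X)).
by apply: polyval_eq => j; rewrite hornerX.
Qed.

Lemma horner_inj (p q : {poly k}) : (forall s, p.[s] = q.[s]) -> p = q.
Proof.
move=> pq; apply/eqP; rewrite -subr_eq0; apply/negPn/negP => /closed_nonrootP[s].
by rewrite rootE hornerD hornerN pq subrr eqxx.
Qed.

(** The line with the coordinates s^2 and s^3 is the cuspidal cubic
    u^3 = v^2. Its regular functions are the polynomials in s with no linear
    term, so that regularity on it expresses the vanishing of the derivative at
    0, and the closure properties of regular functions apply to this
    condition. *)
Definition cusp_coord (s : k) (b : bool) : k := if b then s ^+ 2 else s ^+ 3.

Lemma cusp_inj s t : True -> True -> cusp_coord s =1 cusp_coord t -> s = t.
Proof.
move=> _ _ e; have e2 : s ^+ 2 = t ^+ 2 := e true.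
have e3 : s ^+ 3 = t ^+ 3 := e false.
have [s0|s0] := eqVneq s 0.
  by apply/esym/eqP; move/eqP: e2; rewrite s0 expr0n eq_sym sqrf_eq0.
have s2 : s ^+ 2 != 0 by rewrite sqrf_eq0.
by apply: (mulfI s2); rewrite {2}e2 -!exprSr.
Qed.

Lemma cusp_closed : exists E, forall v,
  zero_locus E v <-> exists2 s, True & cusp_coord s =1 v.
Proof.
apply: (@closed_image_by _ _ _ _ _ (fun f =>
  f = fun v => v true ^+ 3 - v false ^+ 2)).
  by move=> f ->; apply: regularB; apply: regular_exp; apply: regular_proj.
move=> v; split=> [/(_ _ erefl)/eqP|[s _ e] f ->]; last first.
  by rewrite -!e /= -!exprM subrr.
rewrite subr_eq0 => /eqP e; have [v0|v0] := eqVneq (v true) 0.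
  exists 0 => // -[]; rewrite /= expr0n ?v0 //=.
  by apply/esym/eqP; move/eqP: e; rewrite v0 expr0n /= eq_sym sqrf_eq0.
have e2 : (v false / v true) ^+ 2 = v true.
  by rewrite expr_div_n -e exprSr mulrAC divff ?mul1r // sqrf_eq0.
by exists (v false / v true) => // -[] //=; rewrite exprSr e2 mulrCA divff ?mulr1.
Qed.

Definition cusp : affine_variety k k := AffineVariety cusp_inj cusp_closed.

(** The numerical semigroup generated by 2 and 3 misses only 1. *)
Lemma cusp_regular_horner (p : {poly k}) : p`_1 = 0 -> regular cusp (horner p).
Proof.
move=> p1; apply: (@eq_regular _ _ _
  (fun s => \sum_(i < size p) p`_i * s ^+ i)).
  by move=> s _; rewrite horner_coef.
apply: regular_sum => -[i i_lt] _ /=.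
have c2 : regular cusp (fun s => s ^+ 2) := @regular_coord _ _ cusp true.
have c3 : regular cusp (fun s => s ^+ 3) := @regular_coord _ _ cusp false.
have even j : regular cusp (fun s => s ^+ j.*2).
  by apply: eq_regular (regular_exp j c2) => s _; rewrite -exprM mul2n.
case: i {i_lt} => [|[|i]].
- by apply: regularM; [apply: regular_cst | apply: (even 0)].
- by apply: eq_regular (regular_cst cusp 0) => s _; rewrite p1 mul0r.
apply: regularM; first exact: regular_cst.
have [i_odd|i_even] := boolP (odd i.+2).
  apply: eq_regular (regularM c3 (even i./2)) => s _.
  by rewrite -exprD -[in RHS](odd_double_half i); move: i_odd => /= /negPn ->.
apply: eq_regular (even i.+2./2) => s _.
by rewrite -[in RHS](odd_double_half i.+2) (negPf i_even).
Qed.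

(** The polynomials with no linear term form a subring, which contains 'X^2
    and 'X^3. *)
Lemma cusp_linear_coef (p : {poly k}) : regular cusp (horner p) -> p`_1 = 0.
Proof.
move=> [q pq]; pose h b : {poly k} := if b then 'X^2 else 'X^3.
have -> : p = mmap polyC (fun i => h (enum_val i)) q.
  apply: horner_inj => s; rewrite pq // -polyval_horner.
  by apply: polyval_eq => -[]; rewrite /= hornerXn.
have lin0M (u v : {poly k}) : u`_1 = 0 -> v`_1 = 0 -> (u * v)`_1 = 0.
  by move=> u1 v1; rewrite coefM !big_ord_recl big_ord0 /= u1 v1 mulr0 mul0r !addr0.
have lin01 : (1 : {poly k})`_1 = 0 by rewrite coef1.
rewrite /mmap coef_sum big1 // => m _; rewrite coefCM.
suff -> : (mmap1 (fun i => h (enum_val i)) m)`_1 = 0 by rewrite mulr0.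
rewrite /mmap1; apply: (big_ind (fun u : {poly k} => u`_1 = 0)) => // i _.
elim: (m i) => [|j IH]; first by rewrite expr0.
by rewrite exprS; apply: lin0M => //; rewrite /h; case: ifP; rewrite coefXn.
Qed.

End PolynomialFunctions.

(** * Restriction to a face *)

Section MonomialSupports.
Variable n : nat.

Lemma mnm_suppD (m1 m2 : 'X_{1..n}) :
  mnm_supp (m1 + m2)%MM = mnm_supp m1 :|: mnm_supp m2.
Proof. by apply/setP => i; rewrite !inE mnmDE addn_eq0 negb_and. Qed.

Lemma mnm_suppU (i : 'I_n) : mnm_supp U_(i)%MM = [set i].
Proof. by apply/setP => j; rewrite !inE mnm1E (eq_sym j); case: (i == j). Qed.

Lemma mnm_supp_sum (S : {set 'I_n}) :
  mnm_supp (\sum_(j in S) U_(j))%MM = S.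
Proof.
apply/setP => i; rewrite inE mnm_sumE; under eq_bigr do rewrite mnm1E.
have [iS|iS] := boolP (i \in S); first by rewrite (bigD1 i) //= eqxx.
rewrite big1 // => j jS; case: eqP => // ji.
by rewrite -ji jS in iS.
Qed.

End MonomialSupports.

Section FaceRestriction.
Variables (k : closedFieldType) (n : nat) (D : simplicial_complex n).
Variable F : {set 'I_n}.
Hypothesis F_face : F \in faces D.
Local Notation A := (face_ring k D).

(** The homomorphism from the face ring to the polynomial ring on the vertices
    of the face F that sets the other variables to zero. Its target is a domain
    in which degrees add up. *)
Definition face_restrict (f : A) : {mpoly k[n]} :=
  \sum_(m <- msupp (face_repr f) | mnm_supp m \subset F)
    face_coef m f *: 'X_[m].

Lemma face_restrict_coef f m :
  (face_restrict f)@_m = if mnm_supp m \subset F then face_coef m f else 0.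
Proof.
rewrite /face_restrict raddf_sum /=.
under eq_bigr do rewrite mcoeffZ mcoeffX.
have [mF|mF] := ifP; last first.
  rewrite big1 // => m' m'F; case: eqP => [e|_]; last by rewrite mulr0.
  by rewrite -e m'F in mF.
have [mf|mf] := boolP (m \in msupp (face_repr f)).
  rewrite -big_filter (bigD1_seq m) ?mem_filter ?mF ?filter_uniq ?msupp_uniq //=.
  by rewrite eqxx mulr1 big1 ?addr0 // => m' /negPf ->; rewrite mulr0.
rewrite /face_coef (memN_msupp_eq0 mf) big1_seq // => m' /andP[_ m'f].
by case: eqP m'f mf => [->->//|_ _ _]; rewrite mulr0.
Qed.

Lemma sub_face_mnm m : mnm_supp m \subset F -> face_mnm D m.
Proof. exact: face_subset F_face. Qed.

Lemma face_restrict0 : face_restrict 0 = 0.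
Proof.
apply/mpolyP => m; rewrite face_restrict_coef mcoeff0; case: ifP => // mF.
by rewrite face_coef0 ?sub_face_mnm.
Qed.

Lemma face_restrict1 : face_restrict 1 = 1.
Proof.
apply/mpolyP => m; rewrite face_restrict_coef mcoeff1; case: ifP => mF.
  by rewrite -(rmorph1 (face_class D)) face_coef_class ?sub_face_mnm // mcoeff1.
case: eqP mF => // -> /negP[]; apply/subsetP => i.
by rewrite inE mnm0E.
Qed.

Lemma face_restrictM : {morph face_restrict : f g / f * g}.
Proof.
move=> f g; apply/mpolyP => m; rewrite face_restrict_coef mcoeffM.
case: ifP => mF.
  rewrite face_coefM ?sub_face_mnm //; apply: eq_bigr => h /eqP e.
  have /andP[h1 h2] : (mnm_supp h.1 \subset F) && (mnm_supp h.2 \subset F).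
    by rewrite -subUset -mnm_suppD -e.
  by rewrite !face_restrict_coef h1 h2.
rewrite big1 // => h /eqP e; rewrite !face_restrict_coef.
case: ifP => h1; last by rewrite mul0r.
case: ifP => h2; last by rewrite mulr0.
by rewrite e mnm_suppD subUset h1 h2 in mF.
Qed.

Lemma face_restrict_prod I (r : seq I) (P : pred I) (f : I -> A) :
  face_restrict (\prod_(i <- r | P i) f i) =
  \prod_(i <- r | P i) face_restrict (f i).
Proof. exact: (big_morph _ face_restrictM face_restrict1). Qed.

Lemma face_restrict_neq0 f m :
  mnm_supp m \subset F -> face_coef m f != 0 -> face_restrict f != 0.
Proof.
move=> mF; apply: contraNneq => f0.
by have := face_restrict_coef f m; rewrite f0 mcoeff0 mF => <-.
Qed.

End FaceRestriction.

(** * Monomials of the face ring *)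

Section Monomials.
Variables (k : closedFieldType) (n : nat) (D : simplicial_complex n).
Local Notation A := (face_ring k D).
Local Notation x := (xbar k D).

Lemma nonface_class m : ~~ face_mnm D m -> face_class D 'X_[m] = 0 :> A.
Proof.
move=> hm; rewrite -(rmorph0 (face_class D)).
by apply/face_class_eq; rewrite subr0 nonface_mnm.
Qed.

Lemma face_class_mul_prod m (S : {set 'I_n}) :
  mnm_supp m :|: S \notin faces D ->
  face_class D 'X_[m] * \prod_(j in S) x j = 0.
Proof.
move=> mS; rewrite -rmorph_prod mprodXE -rmorphM -mpolyXD.
by apply: nonface_class; rewrite /face_mnm mnm_suppD mnm_supp_sum.
Qed.

Lemma xbar_dvd i (f : A) :
  (forall m, face_mnm D m -> face_coef m f != 0 -> m i != 0%N) ->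
  exists g, f = x i * g.
Proof.
move=> f_i; have [d fd] := degree_le_ex f.
exists (\sum_(m : face_basis D d)
  face_coef m f *: face_class D 'X_[(face_basis_mnm m - U_(i))%MM]).
rewrite {1}[f](face_basisE ((degree_leP _ _).1 fd)) mulr_sumr.
apply: eq_bigr => m _; rewrite -scalerAr -rmorphM -mpolyXD.
have [->|fm] := eqVneq (face_coef (face_basis_mnm m) f) 0; first by rewrite !scale0r.
rewrite addmC submK // lep1mP; exact: f_i (valP m) fm.
Qed.

Lemma torus_coef t phi m f : torus_elt t phi -> face_mnm D m ->
  face_coef m (aut_fun phi f) = (\prod_i t i ^+ m i) * face_coef m (f : A).
Proof.
move=> [_ ht] mD; have [d fd] := degree_le_ex f.
rewrite (lrmorph_expand _ fd) {2}[f](face_basisE ((degree_leP _ _).1 fd)).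
rewrite !face_coef_sum // mulr_sumr; apply: eq_bigr => m' _.
set m1 : 'X_{1..n} := face_basis_mnm m'.
have -> : \prod_i aut_fun phi (x i) ^+ m1 i =
    (\prod_i t i ^+ m1 i) *: face_class D 'X_[m1].
  by rewrite face_classX -scaler_prod; apply: eq_bigr => i _; rewrite ht exprZn.
rewrite !face_coefZ // face_coefX //; case: eqP => [->|_]; last by rewrite !mulr0.
by rewrite mulrCA.
Qed.

End Monomials.

(** * The closure of a face *)

Section Closure.
Variables (n : nat) (D : simplicial_complex n).

(** Any face T containing S lies in a facet, and this facet contains i. *)
Lemma face_closure_cone i (S T : {set 'I_n}) :
  i \in face_closure D S -> S \subset T -> T \in faces D -> i |: T \in faces D.
Proof.
move=> iS ST TD; have [F Fmax TF] := maxset_exists (P := mem (faces D)) TD.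
have iF : i \in F.
  have /bigcapP := iS; apply; apply/andP; split; first exact: Fmax.
  exact: subset_trans ST TF.
by apply: face_subset (maxsetp Fmax) _; rewrite subUset sub1set iF.
Qed.

Lemma face_closure_of_cones i (S : {set 'I_n}) :
  (forall F, F \in faces D -> S \subset F -> i |: F \in faces D) ->
  i \in face_closure D S.
Proof.
move=> cone; apply/bigcapP => F /andP[/maxsetP[FD Fmax] SF].
by rewrite -(Fmax _ (cone F FD SF) (subsetUr _ _)) !inE eqxx.
Qed.

End Closure.

(** * The root subgroup of a Demazure root *)

Section RootAutomorphisms.
Variables (k : closedFieldType) (n : nat) (D : simplicial_complex n).
Variables (i : 'I_n) (m : 'X_{1..n}).
Hypotheses (m_i : m i = 0%N) (m_face : face_mnm D m).
Hypothesis i_closure : i \in face_closure D (mnm_supp m).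
Local Notation A := (face_ring k D).
Local Notation x := (xbar k D).
Local Notation y := (face_class D 'X_[m] : A).

Definition shear_var (s : k) (j : 'I_n) : A := x j + ((j == i)%:R * s) *: y.

Lemma shear_var_id s j : j != i -> shear_var s j = x j.
Proof. by move=> /negPf ji; rewrite /shear_var ji mul0r scale0r addr0. Qed.

(** Expanding the product for a nonface S containing i leaves the term
    s x^m times the x_j, j in S \ i. It vanishes too: were supp(m) and S \ i in
    a common face, i could be added to this face, which would then contain S. *)
Lemma shear_rel s (S : {set 'I_n}) :
  S \notin faces D -> \prod_(j in S) shear_var s j = 0.
Proof.
move=> SD; have [iS|iS] := boolP (i \in S); last first.
  rewrite -[RHS](nonface_prod k SD); apply: eq_bigr => j jS.
  by apply: shear_var_id; apply: contraNneq iS => <-.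
have Si (f : 'I_n -> A) : \prod_(j in S) f j = f i * \prod_(j in S :\ i) f j.
  rewrite (bigD1 i) //; congr (_ * _); apply: eq_bigl => j.
  by rewrite !inE andbC.
rewrite Si.
have -> : \prod_(j in S :\ i) shear_var s j = \prod_(j in S :\ i) x j.
  by apply: eq_bigr => j; rewrite !inE => /andP[/shear_var_id-> _].
rewrite /shear_var mulrDl -Si nonface_prod // add0r -scalerAl.
rewrite face_class_mul_prod ?scaler0 //.
apply: contra SD => /(face_closure_cone i_closure (subsetUl _ _)).
by rewrite setUCA setD1K // => /face_subset; apply; apply: subsetUr.
Qed.

Lemma shear_hom_exists :
  exists F : k -> {lrmorphism A -> A}, forall s j, F s (x j) = shear_var s j.
Proof.
by exists (fun s => face_hom (shear_rel s)) => s j; apply: face_hom_xbar.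
Qed.

(** Obtained by choice, so that simplification leaves it folded. *)
Definition shear_hom : k -> {lrmorphism A -> A} := sval (cid shear_hom_exists).

Lemma shear_hom_xbar s j : shear_hom s (x j) = shear_var s j.
Proof. exact: (svalP (cid shear_hom_exists)). Qed.

Lemma shear_hom_mon s : shear_hom s y = y.
Proof.
rewrite face_classX rmorph_prod; apply: eq_bigr => j _.
rewrite rmorphXn /= shear_hom_xbar.
by have [->|ji] := eqVneq j i; rewrite ?m_i ?expr0 // shear_var_id.
Qed.

Lemma shear_homD s s' f : shear_hom s (shear_hom s' f) = shear_hom (s + s') f.
Proof.
apply: (lrmorph_ext (phi := shear_hom s \o shear_hom s')
  (psi := shear_hom (s + s'))) => j.
rewrite /= !shear_hom_xbar /shear_var linearD linearZ /= shear_hom_xbar.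
by rewrite shear_hom_mon -addrA -scalerDl -mulrDr.
Qed.

Lemma shear_hom0 f : shear_hom 0 f = f.
Proof.
apply: (lrmorph_ext (phi := shear_hom 0) (psi := idfun)) => j.
by rewrite shear_hom_xbar /shear_var mulr0 scale0r addr0.
Qed.

Lemma shear_homK s : cancel (shear_hom s) (shear_hom (- s)).
Proof. by move=> f; rewrite shear_homD addNr shear_hom0. Qed.

Lemma shear_homVK s : cancel (shear_hom (- s)) (shear_hom s).
Proof. by move=> f; rewrite shear_homD addrN shear_hom0. Qed.

Definition shear (s : k) : Aut_X k D := FaceAut (shear_homK s) (shear_homVK s).

Lemma shearD s s' : shear (s + s') = (shear s * shear s')%g.
Proof. by apply: face_aut_eq => f /=; rewrite shear_homD. Qed.

Lemma shear_side s b j :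
  aut_side (shear s) b (x j) = shear_var (if b then s else - s) j.
Proof. by case: b; apply: shear_hom_xbar. Qed.

(** The 1 matters when m is the empty monomial: the shear is then a
    translation, and the x_j still have degree 1. *)
Definition shear_degree := maxn 1 (mdeg m).

Lemma shear_piece s : piece (Aut_X k D) shear_degree (shear s).
Proof.
move=> b j; rewrite shear_side; apply/degree_leP => m' m'D.
rewrite gtn_max => /andP[m'1 m'm].
rewrite face_coefD // face_coefZ // face_coef_xbar // face_coefX //.
case: eqP m'1 => [<-|_ _]; first by rewrite mdeg1.
by case: (m =P m') m'm => [->|_ _]; rewrite ?ltnn // mulr0 addr0.
Qed.

Definition shear_param (phi : Aut_X k D) : k := face_coef m (aut_fun phi (x i)).

Lemma shear_paramE s : shear_param (shear s) = s.
Proof.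
rewrite /shear_param /= shear_hom_xbar face_coefD // face_coefZ //.
rewrite face_coef_xbar // face_coefX // eqxx mul1r eqxx mulr1.
case: eqP => [e|_]; last by rewrite add0r.
by have := m_i; rewrite -e mnm1E eqxx.
Qed.

(** The shears are cut out by the requirement that phi(x_j) be what the
    parameter of phi prescribes. *)
Lemma shear_closed :
  closed_in (piece (Aut_X k D) shear_degree)
    (fun phi => exists s, phi = shear s).
Proof.
apply: (closed_by (F := fun f => exists j m', face_mnm D m' /\
  f = fun phi =>
    face_coef m' (aut_fun phi (x j) - shear_var (shear_param phi) j))).
  move=> f [j [m' [m'D ->]]].
  have reg l := @aut_side_regular k n D shear_degree true l.
  move: m' m'D; apply: face_regularB; first exact: reg.
  apply: (@eq_face_regular _ _ _ _ _ (fun phi =>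
    \sum_(b : bool) (if b then 1 else (j == i)%:R * shear_param phi) *:
      (if b then x j else y))).
    by move=> phi _; rewrite big_bool /= scale1r.
  apply: face_regular_sum => b _; apply: face_regularZ; last exact: face_regular_cst.
  case: b; first exact: regular_cst.
  apply: regularM; first exact: regular_cst.
  exact: reg.
move=> phi; split=> [[s ->]|[_ h]].
  split=> [|f [j [m' [m'D ->]]]]; first exact: shear_piece.
  by rewrite shear_paramE shear_hom_xbar subrr face_coef0.
exists (shear_param phi); apply: face_aut_ext => j; apply/eqP.
rewrite shear_hom_xbar -subr_eq0; apply/eqP.
apply: face_coef_inj => m' m'D; rewrite face_coef0 //.
apply: (h (fun phi =>
  face_coef m' (aut_fun phi (x j) - shear_var (shear_param phi) j))).
by exists j, m'.
Qed.

Definition shear_group : algebraic_subgroup (Aut_X k D).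
Proof.
apply: (AlgebraicSubgroup shear_closed).
- by exists 0; apply: face_aut_eq => f; rewrite /= shear_hom0.
- by move=> _ _ [s ->] [s' ->]; exists (s + s'); rewrite shearD.
- by move=> _ [s ->]; exists (- s); apply: face_aut_eq.
Defined.

Lemma shear_iso : isomorphism (Ga k) shear_group shear.
Proof.
split.
  split=> [s _|[[b j] m']]; first by exists s.
  have m'D : face_mnm D (face_basis_mnm m') := valP m'.
  apply: (@eq_regular _ _ _ (fun s => face_coef (face_basis_mnm m') (x j) +
    (if b then 1 else -1) * s * ((j == i)%:R * face_coef (face_basis_mnm m') y))).
    move=> s _; rewrite /= /aut_coord /= shear_side face_coefD // face_coefZ //.
    by rewrite mulrCA mulrA; case: b; rewrite ?mul1r ?mulN1r.
  apply: regularD; first exact: regular_cst.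
  apply: regularM; last exact: regular_cst.
  apply: regularM; first exact: regular_cst.
  exact: (@regular_coord _ _ (Ga k) tt).
exists shear_param; split=> [|s _|_ [s ->]].
- split=> // -[]; apply: regular_sub.
  exact: (@aut_side_regular k n D shear_degree true i m m_face).
- exact: shear_paramE.
- by rewrite shear_paramE.
Qed.

Lemma shear_conj t phi s : torus_elt t phi ->
  (phi * shear s * phi^-1)%g = shear ((\prod_j t j ^+ m j) / t i * s).
Proof.
move=> ht; apply: face_aut_ext => j.
rewrite shear_hom_xbar /= (torus_elt_side false j ht) /= !linearZ /=.
rewrite shear_hom_xbar /shear_var linearD linearZ /=.
have -> : aut_fun phi y = (\prod_j t j ^+ m j) *: y.
  apply: face_coef_inj => m' m'D; rewrite face_coefZ // (torus_coef _ ht) //.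
  by rewrite face_coefX //; case: eqP => [->|_]; rewrite ?mulr0.
have [t0 ->] := ht; rewrite scalerDr !scalerA mulVf ?t0 // scale1r.
congr (_ + _ *: _); case: eqP => [->|_]; last by rewrite !mul0r mulr0 mul0r.
by rewrite !mul1r mulrC mulrA.
Qed.

End RootAutomorphisms.

(** * The weight of a root subgroup *)

Section Converse.
Variables (k : closedFieldType) (n : nat) (D : simplicial_complex n).
Hypothesis k_char0 : [pchar k] =i pred0.
Variables (alpha : character (T0 k D)) (U : algebraic_subgroup (Aut_X k D)).
Variable e : k -> Aut_X k D.
Hypothesis e_iso : isomorphism (Ga k) U e.
Hypothesis eD : forall s s', e (s + s') = (e s * e s')%g.
Hypothesis alpha_nontrivial : exists2 t, T0 k D t & alpha t != 1.
Hypothesis e_conj :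
  forall t s, T0 k D t -> (t * e s * t^-1)%g = e (alpha t * s).
Local Notation x := (xbar k D).

Lemma orbit0 : e 0 = 1%g.
Proof.
apply: face_aut_eq => f; apply: (can_inj (aut_funK (e 0))).
by rewrite -[in RHS](addr0 0) eD.
Qed.

Lemma orbit_regular l : face_regular (Ga k) (fun s => aut_fun (e s) (x l)).
Proof.
move=> m mD; have reg := @aut_side_regular k n D (asg_level U) true l m mD.
exact: regular_comp e_iso.1 (regular_sub (asg_closed U) reg).
Qed.

Lemma orbit_poly l m : face_mnm D m ->
  exists p : {poly k}, forall s, face_coef m (aut_fun (e s) (x l)) = p.[s].
Proof.
move=> mD; have [p ep] := regular_Ga (orbit_regular l mD).
by exists p => s; rewrite -ep.
Qed.

Lemma orbit_equivariant l m t phi s : face_mnm D m -> torus_elt t phi ->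
  face_coef m (aut_fun (e (alpha phi * s)) (x l)) =
  (\prod_i t i ^+ m i) / t l * face_coef m (aut_fun (e s) (x l)).
Proof.
move=> mD ht; rewrite -e_conj; last by exists t.
rewrite /= (torus_elt_side false l ht) /= !linearZ /= face_coefZ //.
by rewrite (torus_coef _ ht) // mulrA [_ / _]mulrC.
Qed.

(** Compare the coefficients of s^r in the two sides of
    p(alpha(t) s) = (t^m / t_l) p(s). *)
Lemma weight_power l m (p : {poly k}) r : face_mnm D m ->
  (forall s, face_coef m (aut_fun (e s) (x l)) = p.[s]) -> p`_r != 0 ->
  forall t phi, torus_elt t phi -> alpha phi ^+ r = (\prod_i t i ^+ m i) / t l.
Proof.
move=> mD ep pr t phi ht; set c := _ / _.
pose q := \poly_(i < size p) (alpha phi ^+ i * p`_i).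
have /(congr1 (fun u : {poly k} => u`_r)) : q = c *: p.
  apply: horner_inj => s; rewrite hornerZ -ep -(orbit_equivariant l s mD ht) ep.
  rewrite horner_poly horner_coef; apply: eq_bigr => i _.
  by rewrite exprMn mulrA [_ * p`_i]mulrC.
have r_lt : (r < size p)%N.
  by rewrite ltnNge; apply: contra pr => /(nth_default 0) ->.
by rewrite coefZ coef_poly r_lt => /(mulIf pr).
Qed.

(** Derivatives at 0 follow the Leibniz rule: if they vanish on the variables
    they vanish on the whole ring. *)
Lemma orbit_cusp :
  (forall l m (p : {poly k}), face_mnm D m ->
     (forall s, face_coef m (aut_fun (e s) (x l)) = p.[s]) -> p`_1 = 0) ->
  forall f, face_regular (cusp k) (fun s => aut_fun (e s) f).
Proof.
move=> lin0 f; have [d fd] := degree_le_ex f.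
apply: (@eq_face_regular _ _ _ _ _ (fun s => \sum_(m : face_basis D d)
  face_coef (face_basis_mnm m) f *:
  \prod_i aut_fun (e s) (x i) ^+ face_basis_mnm m i)).
  by move=> s _; rewrite (lrmorph_expand _ fd).
apply: face_regular_sum => m _; apply: face_regularZ; first exact: regular_cst.
apply: face_regular_prod => i _; apply: face_regularX => m' m'D.
have [p ep] := orbit_poly i m'D.
apply: eq_regular (cusp_regular_horner (lin0 _ _ _ m'D ep)) => s _.
by rewrite ep.
Qed.

(** Otherwise e(s') f has zero derivative at s' = 0 for every f, in particular
    for f = e(s)(x_l); as e(s') e(s) = e(s' + s), the coefficients of e(s)(x_l)
    have zero derivative at every s. In characteristic zero they are constant,
    and e is not injective. *)
Lemma linear_term_exists : exists l m (p : {poly k}), [/\ face_mnm D m,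
  forall s, face_coef m (aut_fun (e s) (x l)) = p.[s] & p`_1 != 0].
Proof.
apply: contrapT => none.
have lin0 l m (p : {poly k}) : face_mnm D m ->
    (forall s, face_coef m (aut_fun (e s) (x l)) = p.[s]) -> p`_1 = 0.
  by move=> mD ep; apply/eqP/negPn/negP => p1; apply: none; exists l, m, p.
have e_cst : e 1 = e 0.
  apply: face_aut_ext => l; apply: face_coef_inj => m mD.
  have [p ep] := orbit_poly l mD; rewrite !ep.
  have p'0 : p^`() = 0.
    apply: horner_inj => s; rewrite horner0.
    have /cusp_linear_coef : regular (cusp k) (horner (p \Po ('X + s%:P))).
      apply: eq_regular (orbit_cusp lin0 (aut_fun (e s) (x l)) mD) => s' _.
      by rewrite horner_comp hornerD hornerX hornerC -ep eD.
    rewrite -[_`_1]mulr1n -coef_deriv -horner_coef0 deriv_comp.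
    rewrite derivD derivX derivC addr0 mulr1 horner_comp.
    by rewrite hornerD hornerX hornerC add0r.
  have p_cst : p = (p`_0)%:P.
    apply/polyP => -[|i]; rewrite coefC //=.
    have := congr1 (fun u : {poly k} => u`_i) p'0; rewrite coef_deriv coef0.
    by move/eqP; rewrite -mulr_natr mulf_eq0 ((pcharf0P k).1 k_char0) orbF => /eqP.
  by rewrite p_cst !hornerC.
have [_ [g [_ eK _]]] := e_iso.
by have /eqP := eK 1 I; rewrite e_cst eK // eq_sym oner_eq0.
Qed.

(** The polynomial takes the value 1 at s = 0. *)
Lemma orbit_self_poly j : exists2 p : {poly k},
  forall s, face_coef U_(j)%MM (aut_fun (e s) (x j)) = p.[s] & p != 0.
Proof.
have [p ep] := orbit_poly j (face_mnmU D j); exists p => //.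
apply: contraTneq (oner_neq0 k) => p0; rewrite negbK.
have := ep 0; rewrite p0 horner0 orbit0 /= face_coef_xbar ?eqxx => [/eqP//|].
exact: face_mnmU.
Qed.

(** If F contains supp(m) and F together with l is not a face, then e(s) kills
    the product of the x_j for j = l or j in F; restricted to F, this is, for
    general s, a vanishing product of nonzero polynomials. *)
Lemma monomial_supp_closure l m (p : {poly k}) : face_mnm D m ->
  (forall s, face_coef m (aut_fun (e s) (x l)) = p.[s]) -> p != 0 ->
  l \in face_closure D (mnm_supp m).
Proof.
move=> mD ep p0; apply: face_closure_of_cones => F FD mF; apply: contraT => lF.
(* A monomial supported on F that occurs in e(s)(x_j) for general s. *)
pose mu j := if j == l then m else U_(j)%MM.
have /choice[q eq] : forall j, exists q : {poly k},
    (forall s, face_coef (mu j) (aut_fun (e s) (x j)) = q.[s]) /\ q != 0.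
  move=> j; rewrite /mu; case: eqP => [->|_]; first by exists p.
  by have [q qe q0] := orbit_self_poly j; exists q.
have /closed_nonrootP[s] : \prod_j q j != 0.
  by apply/prodf_neq0 => j _; case: (eq j).
rewrite rootE horner_prod => /prodf_neq0 qs.
have /eqP := congr1 (fun f => face_restrict F (aut_fun (e s) f)) (nonface_prod k lF).
rewrite rmorph_prod rmorph0 face_restrict_prod // face_restrict0 //.
move=> /prodf_eq0[j jlF]; rewrite -[_ == 0]negbK => /negP[].
apply: (face_restrict_neq0 (m := mu j)) => //; last by rewrite (eq j).1 qs.
rewrite /mu; case: eqP => [//|/eqP jl].
by move: jlF; rewrite !inE (negPf jl) mnm_suppU sub1set.
Qed.

Lemma two_exp_neq1 q : 2 ^+ q.+1 != 1 :> k.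
Proof.
have q_gt0 : (1 < 2 ^ q.+1)%N by rewrite (leq_trans _ (ltn_expl _ _)).
rewrite -natrX -subr_eq0 -[1]/(1%:R) -natrB ?(ltnW q_gt0) //.
by rewrite ((pcharf0P k).1 k_char0) -lt0n subn_gt0.
Qed.

(** A monomial x^m' of e(s)(x_l) satisfies t^m' / t_l = (t^m / t_l)^r for some
    r. If m'_l were 0, the exponents of t_l would be -1 on the left and
    nonnegative on the right; the values at t_l = 2 tell them apart. *)
Lemma orbit_dvd l m : m l != 0%N ->
  (forall t phi, torus_elt t phi -> alpha phi = (\prod_i t i ^+ m i) / t l) ->
  forall s, exists g, aut_fun (e s) (x l) = x l * g.
Proof.
move=> ml alphaE s; apply: xbar_dvd => m' m'D; apply: contraNneq => m'l.
have [p ep] := orbit_poly l m'D; rewrite ep.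
have [->|p0] := eqVneq p 0; first by rewrite horner0.
have pr : p`_(size p).-1 != 0 by rewrite -/(lead_coef p) lead_coef_eq0.
pose t i : k := if i == l then 2 else 1.
have two0 : 2 != 0 :> k by rewrite ((pcharf0P k).1 k_char0).
have t0 i : t i != 0 by rewrite /t; case: ifP; rewrite ?oner_neq0.
have t_mon u : \prod_i t i ^+ u i = 2 ^+ u l.
  rewrite (bigD1 l) //= big1 ?mulr1 => [|i /negPf il]; first by rewrite /t eqxx.
  by rewrite /t il expr1n.
have [phi ht] := torus_elt_ex D t0.
have := weight_power m'D ep pr ht; rewrite (alphaE t) // !t_mon m'l.
rewrite /t eqxx -(prednK (_ : 0 < m l)%N) ?lt0n // exprSr mulfK // -exprM.
move=> /(congr1 (fun c => c * 2)); rewrite mulfVK // -exprSr expr0 => /eqP.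
by rewrite (negPf (two_exp_neq1 _)).
Qed.

(** If m_l > 0 then x_l divides e(-s)(x_l), hence e(s)(x_l) divides x_l. On the
    face supp(m) the polynomial e(s)(x_l) has degree at least |m|, for general
    s, so that |m| <= 1 and m = e_l, against the nontriviality of alpha. *)
Lemma weight_not_effective l m (p : {poly k}) : face_mnm D m ->
  (forall s, face_coef m (aut_fun (e s) (x l)) = p.[s]) -> p != 0 ->
  (forall t phi, torus_elt t phi -> alpha phi = (\prod_i t i ^+ m i) / t l) ->
  m l = 0%N.
Proof.
move=> mD ep p0 alphaE; apply: contraTeq isT => ml.
have lF : mnm_supp U_(l) \subset mnm_supp m by rewrite mnm_suppU sub1set inE.
have [s] := closed_nonrootP p p0; rewrite rootE -ep => ms.
have [g eg] := orbit_dvd ml alphaE (- s).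
have := congr1 (fun f => face_restrict (mnm_supp m) (aut_fun (e s) f)) eg.
rewrite rmorphM face_restrictM //.
have -> : aut_fun (e s) (aut_fun (e (- s)) (x l)) = x l.
  by rewrite -[RHS]/(aut_fun (1%g : Aut_X k D) (x l)) -orbit0 -(addrN s) eD.
have -> : face_restrict (mnm_supp m) (x l) = 'X_l.
  apply/mpolyP => m'; rewrite face_restrict_coef mcoeffX; case: ifP => m'F.
    by rewrite face_coef_xbar // (sub_face_mnm mD).
  by case: eqP m'F => // <-; rewrite lF.
have R0 := face_restrict_neq0 (subxx (mem (mnm_supp m))) ms.
set R := face_restrict _ _ in R0 *; set Q := face_restrict _ _ => XRQ.
have Q0 : Q != 0.
  by apply: contra_eq_neq XRQ => ->; rewrite mulr0 -msize_poly_eq0 msizeX.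
have m1 : (mdeg m < msize R)%N.
  by apply: msize_mdeg_lt; rewrite mcoeff_msupp face_restrict_coef subxx.
have := congr1 (fun u => msize u) XRQ; rewrite msizeX mdeg1 msizeM //.
move: (Q0); rewrite -msize_poly_eq0 -lt0n => Q1 szR.
have m_le1 : (mdeg m <= 1)%N.
  by move: m1 Q1 szR; set a := mmeasure _ R; set b := mmeasure _ Q; lia.
have [t [u hu]] := alpha_nontrivial; rewrite (alphaE u) //.
have -> : m = U_(l)%MM.
  have := submK (_ : U_(l) <= m)%MM; rewrite lep1mP => /(_ ml) mE.
  have := congr1 (@mdeg n) mE; rewrite mdegD mdeg1 => m_deg.
  have /eqP : mdeg (m - U_(l)) = 0%N by lia.
  by rewrite mdeg_eq0 => /eqP m0; rewrite -mE m0 add0m.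
rewrite (bigD1 l) //= mnm1E eqxx expr1 big1 ?mulr1 ?divff ?eqxx //; first exact: hu.1.
by move=> i /negPf il; rewrite mnm1E eq_sym il expr0.
Qed.

End Converse.

Section Weights.
Variables (k : closedFieldType) (n : nat) (D : simplicial_complex n).

Lemma root_monomial (m : 'X_{1..n}) l t (phi : Aut_X k D) : torus_elt t phi ->
  monomial_fun (\row_j (m j)%:Z - delta_mx 0 l) phi =
  (\prod_i t i ^+ m i) / t l.
Proof.
move=> ht; rewrite (monomial_funE _ ht); have t0 := ht.1.
have -> : t l = \prod_i t i ^+ (i == l).
  by rewrite (bigD1 l) //= eqxx expr1 big1 ?mulr1 // => i /negPf ->.
rewrite -prodf_div; apply: eq_bigr => i _; rewrite !mxE /= expfzDr //.
by case: (i == l); rewrite ?oppr0 ?expr0z ?expr0 ?invr1.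
Qed.

End Weights.

Theorem proposition3p14 (k : closedFieldType) (k_char0 : [pchar k] =i pred0)
  (n : nat) (D : simplicial_complex n) (alpha : character (T0 k D)) :
  root_weight alpha <->
  exists2 a : 'rV[int]_n, demazure_root D a &
    forall t, T0 k D t -> alpha t = monomial_character k D a t.
Proof.
split=> [[U [e [e_iso eD ntriv e_conj]]]|[a [l [b [b_ge0 bl]]]]].
  have [l [m [p [mD ep p1]]]] := linear_term_exists k_char0 e_iso eD.
  have p0 : p != 0 by apply: contraNneq p1 => ->; rewrite coef0.
  have alphaE t phi (ht : torus_elt t phi) :
      alpha phi = (\prod_i t i ^+ m i) / t l.
    by rewrite -(weight_power e_conj mD ep p1 ht) expr1.
  exists (\row_j (m j)%:Z - delta_mx 0 l); last first.
    by move=> phi [t ht]; rewrite (alphaE t) //= (root_monomial _ _ ht).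
  have ml := weight_not_effective k_char0 e_iso eD ntriv e_conj mD ep p0 alphaE.
  exists l, (\row_j (m j)%:Z); split=> // [j||]; rewrite ?mxE ?ml //.
  have -> : [set j | (\row_j (m j)%:Z) 0 j != 0] = mnm_supp m.
    by apply/setP => j; rewrite !inE mxE.
  rewrite inE [_ \in faces D]mD inE ml eqxx /=.
  exact: (monomial_supp_closure e_iso eD mD ep p0).
pose m := [multinom absz (b 0%R j) | j < n].
have {b_ge0} bE : b = \row_j (m j)%:Z.
  by apply/rowP => j; rewrite mxE mnmE gez0_abs.
have -> : [set j | b 0 j != 0] = mnm_supp m.
  by apply/setP => j; rewrite !inE bE mxE.
rewrite inE => /and3P[mD _ l_cl] -> alphaE.
have ml : m l = 0%N by rewrite mnmE bl.
exists (shear_group k ml mD l_cl), (shear ml l_cl); split.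
- exact: shear_iso.
- exact: shearD.
- (* The weight takes the value 1/2 at this point of the torus. *)
  pose t i : k := if i == l then 2 else 1.
  have two0 : 2 != 0 :> k by rewrite ((pcharf0P k).1 k_char0).
  have t0 i : t i != 0 by rewrite /t; case: ifP; rewrite ?oner_neq0.
  have [phi ht] := torus_elt_ex D t0; have T0phi : T0 k D phi by exists t.
  exists phi; rewrite // alphaE //= bE (root_monomial _ _ ht).
  rewrite big1 => [|i _]; last first.
    by rewrite /t; case: eqP => [->|_]; rewrite ?ml ?expr0 ?expr1n.
  rewrite /t eqxx mul1r invr_eq1 -subr_eq0 -[2]/(1 + 1) addrK.
  exact: oner_neq0.
- move=> phi s [t ht]; rewrite (shear_conj ml _ _ ht).
  by rewrite alphaE ?bE /= ?(root_monomial _ _ ht) //; exists t.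
Qed.
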